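(* Let $G\in C^7(\mathbb{R})$ with $G''>0$ and $g:=G-G'\cdot\mathrm{Id}>0$. Let $1\le x_0<x_1<x_2<x_3<x_4<x_5$ be real numbers and define $w_0:[x_0-1,x_5+1]\to\mathbb{R}_{\ge0}$ by $$w_0(x):=\begin{cases}\big(1-(x_0-x)^6\big)^{1/6},& x\in[x_0-1,x_0],\\ 1,& x\in[x_0,x_5],\\ \big(1-(x-x_5)^6\big)^{1/6},& x\in[x_5,x_5+1],\end{cases}$$ and the surface of revolution $$\Sigma:=\big\{\gamma(x,\varphi):=(x,\,w_0(x)\cos\varphi,\,w_0(x)\sin\varphi)\ :\ x\in[x_0-1,x_5+1],\ \varphi\in[0,2\pi]\big\}\subset\mathbb{R}^3 .$$ Let $0<c_{0,I}<c_{0,O}$ be constants and let $c_0\in C^\infty([x_0-1,x_5+1])$ satisfy $c_{0,I}\le c_0\le c_{0,O}$, $c_0=c_{0,O}$ on $[x_0-1,x_1]\cup[x_4,x_5+1]$ and $c_0=c_{0,I}$ on $[x_2,x_3]$. Define $u_0:\Sigma\to\mathbb{R}$ by $u_0(\gamma(x,\varphi)):=c_0(x)$. Then the initial hypersurface $\Gamma_0:=\Sigma$ is a convex surface whose evolution under $$V=g(c)H,\qquad \partial^\square c=\Delta_\Gamma\big(G'(c)\big)+cHV$$ with initial concentration $u_0$ does not stay convex, i.e. there is a time $t>0$ in the existence interval at which the evolving surface $\Gamma(t)$ is not convex.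
   Context: Geometry. A closed hypersurface is a compact connected hypersurface without boundary admitting a continuous unit normal; it is called convex if it is the boundary of a convex set. For an evolving hypersurface $\Gamma(t)=\theta(t,M)$ with global parameterization $\theta:[0,T]\times M\to\mathbb{R}^3$ and unit normal $\nu$, functions on $\Gamma(t)$ are identified with functions on $[0,T]\times M$; $H:=-\mathrm{div}_\Gamma\nu$ is the mean curvature, $V^{\mathrm{tot}}:=\partial_t\theta$, $V:=V^{\mathrm{tot}}\cdot\nu$ is the normal velocity, $\nabla_\Gamma,\Delta_\Gamma$ are the surface gradient and Laplace-Beltrami operator, and $\partial^\square f:=\partial_tf-V^{\mathrm{tot}}\cdot\nabla_\Gamma f$ is the normal time derivative. Meaning of ''evolution''. The evolution is the short-time solution obtained by writing $\Gamma(t)$ as a normal graph over the reference surface $\Sigma$ (with $M=\Sigma$): for a height function $\rho:[0,T]\times\Sigma\to\mathbb{R}$, small in $C^0$, put $\theta_\rho(t,z):=z+\rho(t,z)\nu_\Sigma(z)$, $\Gamma_\rho(t):=\theta_\rho(t,\Sigma)$, $H(\rho):=H_{\Gamma_\rho}$ and $a(\rho):=1/(\nu_\Sigma\cdot\nu_{\Gamma_\rho})$. A known short-time existence theorem (valid for $C^5$ closed hypersurfaces $\Sigma$, $u_0\in C^4(\Sigma)$ and $G\in C^7(\mathbb{R})$ with $G''>0$ and $g:=G-G'\cdot\mathrm{Id}>0$) provides, for sufficiently small $T>0$, functions $\rho,u\in C^1([0,T],C^0(\Sigma))\cap C^0([0,T],C^2(\Sigma))$ solving $$\partial_t\rho=g(u)a(\rho)H(\rho),\qquad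 \partial_tu=\Delta_{\Gamma_\rho}G'(u)+g(u)a(\rho)H(\rho)\,\nu_\Sigma\cdot\nabla_{\Gamma_\rho}u+g(u)H(\rho)^2u$$ on $[0,T]\times\Sigma$ with $\rho(0)=0$, $u(0)=u_0$, and there is a constant $R>0$ with $\|\partial_t\rho(t)-\partial_t\rho(0)\|_{C^0}+\|\rho(t)-\rho(0)\|_{C^2}\le RT^{1/4}$ and the same estimate for $u$, for all $t\in[0,T]$; any two solutions coincide on some interval $[0,\overline T]$, $\overline T\in(0,T]$. Then $\Gamma(t)=\Gamma_\rho(t)$ with concentration $c=u$ (pulled back to $\Sigma$) solves the system $V=g(c)H$, $\partial^\square c=\Delta_\Gamma\big(G'(c)\big)+cHV$ with $\Gamma(0)=\Sigma$, $c(0)=u_0$. *)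

(* Defs.v *)
From HB Require Import structures.
From mathcomp Require Import all_boot all_order all_algebra.
From mathcomp Require Import all_classical all_reals all_analysis.

Set Implicit Arguments.
Unset Strict Implicit.
Unset Printing Implicit Defensive.

Import Order.TTheory GRing.Theory Num.Theory.
Import numFieldNormedType.Exports.

Local Open Scope classical_set_scope.
Local Open Scope ring_scope.

Definition class_C (R : realType) (k : nat) (f : R -> R) :=
  (forall j x, (j < k)%N -> derivable (derive1n j f) x 1) /\ continuous (derive1n k f).

(* [d k] is the [k]-th derivative of [f] relative to [[a, b]], one-sided at the
   end points; values of [f] outside [[a, b]] are irrelevant. *)
Definition smooth_on_itv (R : realType) (a b : R) (f : R -> R) :=
  exists d : nat -> R -> R, {in `[a, b], d 0%N =1 f} /\
    forall k x, x \in `[a, b] ->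
      (d k y - d k x) / (y - x) @[y --> within `[a, b] x^'] --> d k.+1 x.

Section Plane.
Variables (R : realType) (V : normedModType R).
Implicit Types (U : set 'rV[R]_2) (f : 'rV[R]_2 -> V).

Definition pd (i : 'I_2) f : 'rV[R]_2 -> V := 'D_(delta_mx 0 i) f.

Definition pds (s : seq 'I_2) f : 'rV[R]_2 -> V := foldr pd f s.

Definition Ck (k : nat) U f :=
  forall s p, (size s <= k)%N -> U p ->
    {for p, continuous (pds s f)} /\
    ((size s < k)%N -> forall i, derivable (pds s f) p (delta_mx 0 i)).

End Plane.

Definition dot (R : realType) (v w : 'rV[R]_3) : R := \sum_i v 0 i * w 0 i.

Section Hypersurface.
Variable R : realType.
Implicit Types (S : set 'rV[R]_3) (U : set 'rV[R]_2).
Implicit Types (gam X : 'rV[R]_2 -> 'rV[R]_3).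

Definition immersion U X :=
  forall p, U p -> row_free (\matrix_(i < 2) pd i X p).

(* The last condition says that [gam] is an open map onto a relatively open
   part of [S]; hence [gam] is a homeomorphism onto its image. All surfaces are
   of class C^5, which leaves two spare derivatives on the reference normal, so
   that a normal graph of a C^2 height function is still of class C^2. *)
Definition local_param S U gam :=
  [/\ open U, Ck 5 U gam, immersion U gam, set_inj U gam &
    forall V, open V -> V `<=` U ->
      exists2 W, open W & gam @` V = S `&` W].

(* [N] is a continuous unit normal of the surface [theta @` S], as a function
   on [S]; [theta] is its global parametrization. *)
Definition unit_normal S (theta N : 'rV[R]_3 -> 'rV[R]_3) :=
  [/\ {within S, continuous N},
    (forall z, S z -> dot (N z) (N z) = 1) &
    forall U gam p i, local_param S U gam -> U p ->
      dot (N (gam p)) (pd i (theta \o gam) p) = 0].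

Definition closed_hypersurface S :=
  [/\ compact S, connected S,
    (forall z, S z -> exists U gam, local_param S U gam /\ (gam @` U) z) &
    exists N, unit_normal S id N].

Definition bounds_convex S :=
  exists C : set (convex_lmodType 'rV[R]_3), convex_set C /\
    S = closure (C : set 'rV[R]_3) `\` interior (C : set 'rV[R]_3).

Definition Ck_on S (k : nat) (f : 'rV[R]_3 -> R) :=
  forall U gam, local_param S U gam -> Ck k U (f \o gam).

(* Surface calculus on the image of an immersion [X], in the coordinates given
   by [X]; scalar and vector fields are functions of the coordinates. *)
Definition metric X (p : 'rV[R]_2) : 'M[R]_2 :=
  \matrix_(i, j) dot (pd i X p) (pd j X p).

Definition surf_grad X (f : 'rV[R]_2 -> R) (p : 'rV[R]_2) : 'rV[R]_3 :=
  \sum_i \sum_j (invmx (metric X p) i j * pd i f p) *: pd j X p.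

Definition surf_div X (W : 'rV[R]_2 -> 'rV[R]_3) (p : 'rV[R]_2) : R :=
  \sum_i \sum_j invmx (metric X p) i j * dot (pd i W p) (pd j X p).

Definition laplace_beltrami X (f : 'rV[R]_2 -> R) : 'rV[R]_2 -> R :=
  surf_div X (surf_grad X f).

Definition mean_curv X (N : 'rV[R]_2 -> 'rV[R]_3) (p : 'rV[R]_2) : R :=
  - surf_div X N p.

End Hypersurface.

Section Evolution.
Variable R : realType.
Implicit Types (S : set 'rV[R]_3) (f rho u : R -> 'rV[R]_3 -> R).

Definition C0_C0 S (T : R) f :=
  forall t, t \in `[0, T] ->
    {within S, continuous (f t)} /\
    forall e, 0 < e -> \forall s \near within `[0, T] (nbhs t),
      forall z, S z -> `|f s z - f t z| <= e.

Definition C1_C0 S (T : R) f (df : R -> 'rV[R]_3 -> R) :=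
  [/\ C0_C0 S T f, C0_C0 S T df &
    forall t, t \in `[0, T] ->
      forall e, 0 < e -> \forall s \near within `[0, T] t^',
        forall z, S z -> `|(f s z - f t z) / (s - t) - df t z| <= e].

(* The topology of C^2(S) is that of uniform convergence of all derivatives of
   order at most 2 on compact subsets of coordinate domains. *)
Definition C0_C2 S (T : R) f :=
  forall t, t \in `[0, T] ->
    Ck_on S 2 (f t) /\
    forall U gam K idx e, local_param S U gam -> compact K -> K `<=` U ->
      (size idx <= 2)%N -> 0 < e ->
      \forall s \near within `[0, T] (nbhs t), forall p, K p ->
        `|pds idx (f s \o gam) p - pds idx (f t \o gam) p| <= e.

Definition graph_param (nu : 'rV[R]_3 -> 'rV[R]_3) rho (t : R) (z : 'rV[R]_3) :=
  z + rho t z *: nu z.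

Definition graph_surface S (nu : 'rV[R]_3 -> 'rV[R]_3) rho (t : R) :=
  graph_param nu rho t @` S.

Definition gfun (G : R -> R) (c : R) : R := G c - derive1 G c * c.

(* [graph_param nu rho t] parametrizes an embedded surface whose unit normal
   [N t] is the one on the same side as [nu]. The smallness of [rho] enters
   only through these three conditions. *)
Definition admissible S (nu : 'rV[R]_3 -> 'rV[R]_3) (T : R) rho
    (N : R -> 'rV[R]_3 -> 'rV[R]_3) :=
  forall t, t \in `[0, T] ->
    let theta := graph_param nu rho t in
    [/\ set_inj S theta,
      (forall U gam, local_param S U gam -> immersion U (theta \o gam)),
      unit_normal S theta (N t) &
      forall z, S z -> 0 < dot (nu z) (N t z)].

(* Short time solution on [[0, T]] starting from the surface [S] with unit
   normal [nu] and the concentration [u0]. *)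
Definition evolution (G : R -> R) S (nu : 'rV[R]_3 -> 'rV[R]_3)
    (u0 : 'rV[R]_3 -> R) (T : R) rho u :=
  exists drho du : R -> 'rV[R]_3 -> R, exists N : R -> 'rV[R]_3 -> 'rV[R]_3,
    [/\ 0 < T, C1_C0 S T rho drho /\ C0_C2 S T rho,
      C1_C0 S T u du /\ C0_C2 S T u,
      admissible S nu T rho N /\
      (forall z, S z -> rho 0 z = 0 /\ u 0 z = u0 z) &
      forall t U gam p, t \in `[0, T] -> local_param S U gam -> U p ->
        let z := gam p in
        let X := graph_param nu rho t \o gam in
        let H := mean_curv X (N t \o gam) p in
        let a := (dot (nu z) (N t z))^-1 in
        let c := u t \o gam in
        drho t z = gfun G (c p) * a * H /\
        du t z = laplace_beltrami X (derive1 G \o c) p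
          + gfun G (c p) * a * H * dot (nu z) (surf_grad X c p)
          + gfun G (c p) * H ^+ 2 * c p].

Definition energy_density (G : R -> R) :=
  [/\ class_C 7 G, (forall c, 0 < derive1n 2 G c) & (forall c, 0 < gfun G c)].

(* Existence part of the short time theory, for arbitrary initial data. *)
Definition short_time_existence :=
  forall (G : R -> R) S (nu : 'rV[R]_3 -> 'rV[R]_3) (u0 : 'rV[R]_3 -> R),
    energy_density G -> closed_hypersurface S -> unit_normal S id nu ->
    Ck_on S 4 u0 ->
    exists2 T0, 0 < T0 & forall T, 0 < T -> T <= T0 ->
      exists rho u, evolution G S nu u0 T rho u.

End Evolution.

Section Capsule.
Variables (R : realType) (x0 x5 : R).

Definition w0 (x : R) : R :=
  if x <= x0 then (1 - (x0 - x) ^+ 6) `^ (6%:R^-1)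
  else if x <= x5 then 1
  else (1 - (x - x5) ^+ 6) `^ (6%:R^-1).

Definition revol (x phi : R) : 'rV[R]_3 :=
  \row_j [:: x; w0 x * cos phi; w0 x * sin phi]`_j.

Definition capsule : set 'rV[R]_3 :=
  [set revol x phi | x in `[x0 - 1, x5 + 1] & phi in `[0, pi *+ 2]].

End Capsule.

(* Main.v *)
Require Import Defs.
From mathcomp Require Import all_boot all_order all_algebra.
From mathcomp Require Import all_classical all_reals all_analysis.
From mathcomp Require Import ring lra.
Import Order.TTheory GRing.Theory Num.Theory.
Import numFieldNormedType.Exports.
Local Open Scope classical_set_scope.
Local Open Scope ring_scope.

(** Loss of convexity comes from the unequal speed of the cylindrical part of the
capsule. There the mean curvature is constant, and with [V = g(c) H] every point
moves inwards along its own ray with initial speed [g(c)]. Since [g' = - G'' c]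
is negative for positive [c], the middle part, where the concentration is the
smaller constant, shrinks faster than the two outer parts. After a short time the
surface therefore has a waist: the parallel over a point [xm] of the middle part
has a smaller radius than the parallels over points [xa] and [xb] on either side
of it. A surface with a waist does not bound a convex set.

The evolution enters through its time derivative at time 0 only
([initial_velocity]): the convergence of the difference quotients is uniform in
space, so that one small time serves for all points of the three parallels. The
computation of this derivative needs the mean curvature of the cylinder for an
arbitrary unit normal ([mean_curv_cyl]); as such a normal is only known to be
continuous, its sign relative to the radial direction is first shown to be
locally constant.

Non-convexity is elementary ([surrounded_interior], [waist_not_convex]): if each
open octant around a point contains a point of the closure of a convex set, then
the point is interior to the set. On the outer parallels there are eight points
in the octants around a point of the middle one, which thus cannot belong to the
boundary.

For the statements about the initial surface, the capsule is written as the zero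
set of the convex C^5 function
[capsule_fun = max(0, x0 - x)^6 + max(0, x - x5)^6 + (y^2 + z^2)^3 - 1]
([capsuleE]). Its sublevel set is the solid capsule, its normalized gradient is
the unit normal. Charts of class C^5 are given explicitly, by the angle away from
the poles ([local_param_tube]) and as graphs near the poles ([local_param_cap]).
Their regularity, and that of the initial concentration, follows from a calculus
of C^k functions closed under sums, products and composition. *)

Set Implicit Arguments.
Unset Strict Implicit.
Unset Printing Implicit Defensive.

(** * Functions of class C^k *)

Lemma cvg_row (R : realType) (T : Type) (F : set_system T) (FF : Filter F) n
    (f : T -> 'rV[R]_n) (l : 'rV[R]_n) :
  (forall j, f x 0 j @[x --> F] --> l 0 j) -> f x @[x --> F] --> l.
Proof.
move=> fl A [P lP sPA].
have : \forall x \near F, forall j, P 0 j (f x 0 j).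
  by apply: filter_forall => j; apply: fl; exact: lP.
by apply: filterS => x Px; apply: sPA => i j; rewrite (ord1 i).
Qed.

Section Ck.
Variables (R : realType) (X : normedModType R) (I : Type) (e : I -> X).

(** Class C^k on [U] along the family of directions [e]. The derivatives are
quantified existentially instead of being iterated values of the derivation
operator, so that the closure properties go through by a plain induction on
[k]; [CkP] below recovers the iterated partial derivatives. *)
Fixpoint ck (W : normedModType R) (k : nat) (U : set X) (f : X -> W) : Prop :=
  (forall p, U p -> {for p, continuous f}) /\
  if k is k'.+1 then
    forall i, exists2 f' : X -> W,
      forall p, U p -> is_derive p (e i) f (f' p) & ck k' U f'
  else True.

Lemma ck_cont (W : normedModType R) k U (f : X -> W) :
  ck k U f -> forall p, U p -> {for p, continuous f}.
Proof. by case: k => [|k] []. Qed.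

Lemma ckS (W : normedModType R) k U (f : X -> W) : ck k.+1 U f -> ck k U f.
Proof.
elim: k f => [|k IH] f [cf df]; first by split.
split=> // i; have [f' f'f cf'] := df i.
by exists f' => //; exact: IH.
Qed.

Lemma ckW (W : normedModType R) j k U (f : X -> W) :
  (j <= k)%N -> ck k U f -> ck j U f.
Proof.
move=> /subnKC <-; elim: (k - j)%N => [|m IH]; first by rewrite addn0.
by rewrite addnS => /ckS /IH.
Qed.

Lemma ck_sub (W : normedModType R) k U V (f : X -> W) :
  V `<=` U -> ck k U f -> ck k V f.
Proof.
move=> VU; elim: k f => [|k IH] f [cf df].
  by split=> // p /VU; exact: cf.
split=> [p /VU|i]; first exact: cf.
have [f' f'f /IH cf'] := df i.
by exists f' => // p /VU; exact: f'f.
Qed.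

(** Only the germs of a function matter for its derivatives; this is where the
openness of the domain enters. *)
Lemma ck_eq (W : normedModType R) k U (f g : X -> W) :
  open U -> (forall p, U p -> f p = g p) -> ck k U f -> ck k U g.
Proof.
move=> oU fg.
have nfg p : U p -> \near p, f p = g p.
  by move=> Up; apply: filterS fg _; exact: open_nbhs_nbhs.
have cg : (forall p, U p -> {for p, continuous f}) ->
    forall p, U p -> {for p, continuous g}.
  move=> cf p Up; have cfp : f x @[x --> p] --> f p := cf p Up.
  rewrite (fg p Up) in cfp; apply: cvg_trans cfp; apply: near_eq_cvg.
  exact: nfg.
case: k => [|k] [cf df]; split; try exact: cg; first by [].
move=> i; have [f' f'f cf'] := df i; exists f' => // p Up.
by apply: near_eq_is_derive (f'f p Up); exact: nfg.
Qed.

Lemma ck_cst (W : normedModType R) k U (c : W) : ck k U (fun _ : X => c).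
Proof.
elim: k c => [|k IH] c; split=> //; try (by move=> p _; exact: cvg_cst).
move=> i; exists (fun=> 0); last exact: IH.
by move=> p _; exact: is_derive_cst.
Qed.

Lemma ckD (W : normedModType R) k U (f g : X -> W) :
  ck k U f -> ck k U g -> ck k U (fun p => f p + g p).
Proof.
elim: k f g => [|k IH] f g [cf df] [cg dg]; split=> //;
  try (by move=> p Up; apply: cvgD; [exact: cf|exact: cg]).
move=> i; have [f' f'f cf'] := df i; have [g' g'g cg'] := dg i.
exists (fun p => f' p + g' p); last exact: IH.
by move=> p Up; apply: is_deriveD; [exact: f'f|exact: g'g].
Qed.

Lemma ckN (W : normedModType R) k U (f : X -> W) :
  ck k U f -> ck k U (fun p => - f p).
Proof.
elim: k f => [|k IH] f [cf df]; split=> //;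
  try (by move=> p Up; apply: cvgN; exact: cf).
move=> i; have [f' f'f cf'] := df i.
exists (fun p => - f' p); last exact: IH.
by move=> p Up; apply: is_deriveN; exact: f'f.
Qed.

Lemma ckM k U (f g : X -> R) :
  ck k U f -> ck k U g -> ck k U (fun p => f p * g p).
Proof.
elim: k f g => [|k IH] f g kf kg; have [cf df] := kf; have [cg dg] := kg;
  split=> //; try (by move=> p Up; apply: cvgM; [exact: cf|exact: cg]).
move=> i; have [f' f'f cf'] := df i; have [g' g'g cg'] := dg i.
exists (fun p => f p * g' p + g p * f' p).
  move=> p Up; have := f'f p Up; have := g'g p Up => ? ?.
  exact: is_deriveM.
by apply: ckD; apply: IH => //; exact: ckS.
Qed.

Lemma ckX n k U (f : X -> R) : ck k U f -> ck k U (fun p => f p ^+ n).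
Proof.
move=> kf; elim: n => [|n IH].
  by under eq_fun do rewrite expr0; exact: ck_cst.
by under eq_fun do rewrite exprS; exact: ckM.
Qed.

Lemma ck_row n k U (f : X -> 'rV[R]_n) :
  (forall j, ck k U (fun p => f p 0 j)) <-> ck k U f.
Proof.
split.
  elim: k f => [|k IH] f kf; split=> //;
    try (by move=> p Up; apply: cvg_row => j; exact: (ck_cont (kf j))).
  move=> i.
  have /choice[f' hf'] : forall j, exists f' : X -> R,
      (forall p, U p -> is_derive p (e i) (fun p => f p 0 j) (f' p)) /\
      ck k U f'.
    by move=> j; have [_ /(_ i)[f' ? ?]] := kf j; exists f'.
  exists (fun p => \row_j f' j p).
    move=> p Up.
    have df : derivable f p (e i).
      apply/derivable_mxP => a b; rewrite (ord1 a).
      by have [/(_ p Up)[]] := hf' b.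
    split=> //; rewrite derive_mx//; apply/rowP => j; rewrite !mxE.
    by have [/(_ p Up)[]] := hf' j.
  apply: IH => j; under eq_fun do rewrite mxE.
  by have [] := hf' j.
elim: k f => [|k IH] f [cf df] j; split=> //;
  try (by move=> p Up; apply: (cvg_comp f (fun M : 'rV[R]_n => M 0 j));
    [exact: cf|exact: coord_continuous]).
move=> i; have [f' f'f cf'] := df i; exists (fun p => f' p 0 j); last exact: IH.
move=> p Up; have [fd fE] := f'f p Up; split.
  exact: (derivable_mxP f p (e i)).1 fd 0 j.
by rewrite -fE derive_mx// mxE.
Qed.

End Ck.

Definition ck1 (R : realType) := @ck R R unit (fun=> 1).
Definition ck2 (R : realType) := @ck R 'rV[R]_2 'I_2 (delta_mx 0).

Section Chain.
Variables (R : realType).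

(** A directional derivative is an ordinary derivative along a line. This gives a
chain rule that asks the inner function for one directional derivative only,
not for differentiability. *)
Lemma is_derive_line (X W : normedModType R) (f : X -> W) p v df :
  is_derive p v f df <-> is_derive (0 : R) 1 (fun t : R => f (t *: v + p)) df.
Proof.
have E : 'D_v f p = 'D_1 (fun t : R => f (t *: v + p)) 0.
  rewrite /derive; set g1 := fun h => h^-1 *: _; set g2 := fun h => h^-1 *: _.
  suff -> : g1 = g2 by [].
  by rewrite funeqE /g1 /g2 => h /=; rewrite addr0 scale0r add0r [_%:A]mulr1.
split=> -[d dE]; split.
- exact: (derivable1P f p v).1 d.
- by rewrite -E.
- exact: (derivable1P f p v).2 d.
- by rewrite E.
Qed.

Lemma is_derive_chain (X : normedModType R) (f : R -> R) (h : X -> R) p v df dh :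
  is_derive (h p) 1 f df -> is_derive p v h dh ->
  is_derive p v (fun q => f (h q)) (df * dh).
Proof.
move=> fd /is_derive_line hd; apply/is_derive_line.
rewrite -[p in h p]add0r -[in h _](scale0r v) in fd.
exact: (@is_derive1_comp _ f (fun t => h (t *: v + p)) 0 df dh fd hd).
Qed.

Lemma ck_comp (X : normedModType R) (I : Type) (e : I -> X) k D U
    (f : R -> R) (h : X -> R) :
  ck1 k D f -> ck e k U h -> (forall p, U p -> D (h p)) ->
  ck e k U (fun p => f (h p)).
Proof.
elim: k f h => [|k IH] f h kf kh UD; have [cf df] := kf;
  have [ch dh] := kh; (split=> //; try (by move=> p Up;
    apply: (cvg_comp h f); [exact: ch|exact: cf (UD _ Up)])) => //.
move=> i; have [f' f'f cf'] := df tt; have [h' h'h ch'] := dh i.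
exists (fun p => f' (h p) * h' p).
  by move=> p Up; apply: is_derive_chain; [exact: f'f (UD _ Up)|exact: h'h].
apply: ckM => //; apply: IH => //; exact: ckS.
Qed.

(** The innermost derivative of an iterated partial derivative is the last index of
the sequence, hence the induction peels sequences from the right. *)
Lemma CkP (W : normedModType R) k (U : set 'rV[R]_2) (f : 'rV[R]_2 -> W) :
  open U -> Ck k U f <-> ck2 k U f.
Proof.
move=> oU; elim: k f => [|k IH] f.
  split=> [kf|[cf _] s p]; last by case: s => // _ Up; split=> //; exact: cf.
  by split=> // p Up; have [] := kf [::] p isT Up.
split.
  move=> kf; split=> [p Up|i]; first by have [] := kf [::] p isT Up.
  exists (pd i f).
    move=> p Up; apply: derivableP.
    by have [_ /(_ isT)] := kf [::] p isT Up.
  apply/IH => s p sk Up; have := kf (rcons s i) p.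
  by rewrite size_rcons /pds foldr_rcons; exact.
move=> [cf df] s p; case/lastP: s => [_ Up|s i].
  split=> [|_ i]; first exact: cf.
  by have [f' /(_ p Up)[]] := df i.
rewrite size_rcons /pds foldr_rcons => sk Up; have [f' f'f cf'] := df i.
suff /IH : ck2 k U (pd i f) by move=> /(_ s p sk Up).
by apply: ck_eq cf' => // q Uq; have [_ <-] := f'f q Uq.
Qed.

Lemma pd_coord i j (p : 'rV[R]_2) :
  is_derive p (delta_mx 0 i) (fun q : 'rV[R]_2 => q 0 j) (i == j)%:R.
Proof.
have d : derivable (id : 'rV[R]_2 -> _) p (delta_mx 0 i) by exact: derivable_id.
split; first by have /derivable_mxP/(_ 0 j) := d.
have E : delta_mx 0 i = \row_k 'D_(delta_mx 0 i) (fun q : 'rV[R]_2 => q 0 k) p.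
  rewrite -[LHS](derive_id p (delta_mx 0 i)) derive_mx//.
  by apply/rowP => l; rewrite !mxE.
by have := congr1 (fun M : 'rV[R]_2 => M 0 j) E; rewrite !mxE eq_sym.
Qed.

Lemma ck2_coord k U j : ck2 k U (fun p : 'rV[R]_2 => p 0 j).
Proof.
have cc (p : 'rV[R]_2) : {for p, continuous (fun p : 'rV[R]_2 => p 0 j)}.
  exact: coord_continuous.
case: k => [|k]; split=> // i.
by exists (fun=> (i == j)%:R); [move=> p _; exact: pd_coord|exact: ck_cst].
Qed.

Lemma ck1_id k D : ck1 k D (fun x : R => x).
Proof.
case: k => [|k]; split=> //; try by move=> p _; exact: cvg_id.
move=> i; exists (fun=> 1); last exact: ck_cst.
by move=> p _; exact: is_derive_id.
Qed.

Lemma ck1_sincos k D : ck1 k D (@sin R) /\ ck1 k D (@cos R).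
Proof.
elim: k => [|k [IHs IHc]].
  by split; split=> // x _; [exact: continuous_sin|exact: continuous_cos].
split; split=> [x _| i]; [exact: continuous_sin | | exact: continuous_cos |].
  by exists (@cos R) => // x _; exact: is_derive_sin.
exists (fun x : R => - sin x); last exact: ckN.
by move=> x _; exact: is_derive_cos.
Qed.

Lemma ck1_powR k a : ck1 k [set x | 0 < x] (fun x : R => x `^ a).
Proof.
have cp b (x : R) : 0 < x -> {for x, continuous (fun x : R => x `^ b)}.
  move=> x0; apply/differentiable_continuous/derivable1_diffP.
  by have [] := is_derive1_powR b x0.
elim: k a => [|k IH] a; first by split=> // x x0; exact: cp.
split=> [x x0|i]; first exact: cp.
exists (fun x : R => a * x `^ (a - 1)).
  by move=> x x0; exact: is_derive1_powR.
by apply: ckM; [exact: ck_cst|exact: IH].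
Qed.

(** At the kink the difference quotient is at most |h|^(n+1), hence tends to 0;
this is why the capsule, built from sixth powers of positive parts, is of class
C^5 across the circles where the caps are glued. *)
Lemma is_derive_maxX n (x : R) :
  is_derive x 1 (fun t => Num.max 0 t ^+ n.+2) (n.+2%:R * Num.max 0 x ^+ n.+1).
Proof.
have /orP[x0|/orP[x0|/eqP ->]] : [|| x < 0, 0 < x | x == 0].
    by case: ltgtP.
- apply: (near_eq_is_derive (f := fun=> 0)).
    near=> t; rewrite /= max_l ?expr0n//.
    by apply: ltW; near: t; exact: lt_nbhsl.
  by rewrite max_l ?(ltW x0)// expr0n mulr0; exact: is_derive_cst.
- apply: (near_eq_is_derive (f := fun t : R => (t ^+ n.+2 : R))).
    near=> t; rewrite /= max_r//.
    by apply: ltW; near: t; exact: lt_nbhsr.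
  rewrite max_r ?(ltW x0)//.
  split; first exact: exprn_derivable.
  by rewrite exp_derive [LHS]mulr1.
- rewrite maxxx expr0n mulr0.
  have L : (fun h : R => h^-1 *:
      (Num.max 0 (h *: 1 + 0 : R) ^+ n.+2 - Num.max 0 (0 : R) ^+ n.+2) : R)
      @ 0^' --> (0 : R).
    apply/cvgr0Pnorm_le => e e0; near=> h.
    rewrite maxxx expr0n/= subr0 addr0 [h *: 1]mulr1.
    have h0 : h != 0 by near: h; exact: nbhs_dnbhs_neq.
    have h1 : `|h| <= 1 by apply: ltW; near: h; exact: dnbhs0_lt.
    have he : `|h| <= e by apply: ltW; near: h; exact: dnbhs0_lt.
    rewrite /GRing.scale/= normrM normfV normrX.
    have hm : `|Num.max 0 h| <= `|h|.
      by case: (leP 0 h) => // _; rewrite normr0.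
    rewrite mulrC ler_pdivrMr ?normr_gt0// (le_trans (lerXn2r _ _ _ hm)) ?nnegrE//.
    rewrite exprS mulrC ler_wpM2r//.
    apply: le_trans he; rewrite exprS -[leRHS]mulr1 ler_wpM2l//.
    exact: exprn_ile1.
  split; first by apply/cvg_ex; exists 0.
  exact: cvg_lim L.
Unshelve. all: by end_near. Qed.

Lemma ck1_maxX k : ck1 k setT (fun t : R => Num.max 0 t ^+ k.+1).
Proof.
have cX n (x : R) : {for x, continuous (fun t : R => Num.max 0 t ^+ n.+1)}.
  apply: (@continuous_comp _ _ _ (fun t : R => Num.max 0 t) (fun t => t ^+ n.+1)).
    by apply: continuous_max; [exact: cst_continuous|exact: cvg_id].
  exact: exprn_continuous.
elim: k => [|k IH]; first by split=> // x _; exact: cX.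
split=> [x _|i]; first exact: cX.
exists (fun t : R => k.+2%:R * Num.max 0 t ^+ k.+1).
  by move=> x _; exact: is_derive_maxX.
by apply: ckM => //; exact: ck_cst.
Qed.

End Chain.

(** * Vectors, charts from inverses, and the equation of the capsule *)

Lemma ord2_ind (P : 'I_2 -> Prop) : P 0 -> P 1 -> forall j, P j.
Proof.
move=> P0 P1 [[|[|//]] i].
- by rewrite (_ : Ordinal i = 0)//; exact: val_inj.
- by rewrite (_ : Ordinal i = 1)//; exact: val_inj.
Qed.

Lemma ord3_ind (P : 'I_3 -> Prop) : P 0 -> P 1 -> P 2%:R -> forall j, P j.
Proof.
move=> P0 P1 P2 [[|[|[|//]]] i].
- by rewrite (_ : Ordinal i = 0)//; exact: val_inj.
- by rewrite (_ : Ordinal i = 1)//; exact: val_inj.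
- by rewrite (_ : Ordinal i = 2%:R)//; exact: val_inj.
Qed.

Section Vec.
Variable R : realType.
Implicit Types (v w : 'rV[R]_3).

Definition vec3 (x y z : R) : 'rV[R]_3 := \row_j [:: x; y; z]`_j.

Lemma vec3E x y z :
  ((vec3 x y z 0 0 = x) * (vec3 x y z 0 1 = y) * (vec3 x y z 0 2%:R = z))%type.
Proof. by rewrite !mxE. Qed.

Lemma row3P v w :
  v 0 0 = w 0 0 -> v 0 1 = w 0 1 -> v 0 2%:R = w 0 2%:R -> v = w.
Proof. by move=> *; apply/rowP; exact: ord3_ind. Qed.

Lemma sum_ord2 (V : nmodType) (F : 'I_2 -> V) : \sum_i F i = F 0 + F 1.
Proof.
rewrite !big_ord_recl big_ord0 addr0; congr (F _ + F _); exact: val_inj.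
Qed.

Lemma sum_ord3 (V : nmodType) (F : 'I_3 -> V) :
  \sum_i F i = F 0 + F 1 + F 2%:R.
Proof.
rewrite !big_ord_recl big_ord0 addr0 addrA.
by congr (F _ + F _ + F _); exact: val_inj.
Qed.

Lemma dot3E v w :
  dot v w = v 0 0 * w 0 0 + v 0 1 * w 0 1 + v 0 2%:R * w 0 2%:R.
Proof. exact: sum_ord3. Qed.

Lemma pd_row3 i (gam : 'rV[R]_2 -> 'rV[R]_3) p d0 d1 d2 :
  is_derive p (delta_mx 0 i) (fun q => gam q 0 0) d0 ->
  is_derive p (delta_mx 0 i) (fun q => gam q 0 1) d1 ->
  is_derive p (delta_mx 0 i) (fun q => gam q 0 2%:R) d2 ->
  pd i gam p = vec3 d0 d1 d2.
Proof.
move=> [g0 e0] [g1 e1] [g2 e2].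
have dg : derivable gam p (delta_mx 0 i).
  apply/derivable_mxP => a b; rewrite (ord1 a); move: b.
  exact: (@ord3_ind (fun b => derivable (fun q => gam q 0 b) p (delta_mx 0 i))).
by rewrite /pd derive_mx//; apply: row3P; rewrite vec3E mxE.
Qed.

(** To see that a parametrization is a homeomorphism onto a relatively open piece
of the surface, it suffices to exhibit a continuous left inverse on an open set
of space that cuts out exactly this piece; the images of open sets are then
preimages under this inverse. *)
Lemma local_param_of_inverse (S W : set 'rV[R]_3) U gam psi :
  open U -> Ck 5 U gam -> immersion U gam -> open W ->
  (forall p, U p -> [/\ S (gam p), W (gam p) & psi (gam p) = p]) ->
  (forall z, W z -> {for z, continuous psi}) ->
  (forall z, S z -> W z -> U (psi z) /\ gam (psi z) = z) ->
  local_param S U gam.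
Proof.
move=> oU kg ig oW gU cpsi psiK; split=> //.
  move=> p q /set_mem Up /set_mem Uq pq.
  by have [_ _ <-] := gU p Up; have [_ _ <-] := gU q Uq; rewrite pq.
move=> V oV VU; exists (W `&` psi @^-1` V).
  rewrite openE => z [Wz Vz]; apply: filterI; first exact: open_nbhs_nbhs.
  by apply: (cpsi z Wz); exact: open_nbhs_nbhs.
apply/seteqP; split=> [_ [p Vp <-]|z [Sz [Wz Vz]]].
  have [? ? e] := gU p (VU p Vp); split=> //; split=> //=.
  by rewrite e.
by exists (psi z) => //; have [] := psiK z Sz Wz.
Qed.

Lemma local_param_sub S U (gam : 'rV[R]_2 -> 'rV[R]_3) p :
  local_param S U gam -> U p -> S (gam p).
Proof.
move=> [oU _ _ _ /(_ U oU (fun _ x => x))[W _ E]] Up.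
by have : (gam @` U) (gam p) by [exists p]; rewrite E => -[].
Qed.

(** Polar coordinates with the angle in one full turn: the arc cosine covers the
upper half plane, its reflection the lower one. *)
Lemma polar (a b : R) : exists2 phi, phi \in `[0, pi *+ 2] &
  a = Num.sqrt (a ^+ 2 + b ^+ 2) * cos phi /\
  b = Num.sqrt (a ^+ 2 + b ^+ 2) * sin phi.
Proof.
set r := Num.sqrt _.
have r2 : r ^+ 2 = a ^+ 2 + b ^+ 2 by rewrite sqr_sqrtr// addr_ge0// sqr_ge0.
have r0 : 0 <= r by exact: sqrtr_ge0.
have pi0 : 0 < pi :> R := pi_gt0 R.
have [rE|rn] := eqVneq r 0.
  exists 0; first by rewrite in_itv/= lexx/= mulrn_wge0// ltW.
  by split; rewrite rE mul0r; nra.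
have rgt : 0 < r by rewrite lt_neqAle eq_sym rn.
have cE : r ^+ 2 * (1 - (a / r) ^+ 2) = b ^+ 2.
  by rewrite mulrBr mulr1 exprMn exprVn mulrCA mulfV ?expf_neq0// mulr1 r2 addrC addKr.
have b0 : 0 <= 1 - (a / r) ^+ 2.
  have r2gt : 0 < r ^+ 2 by exact: exprn_gt0.
  have : 0 <= r ^+ 2 * (1 - (a / r) ^+ 2) by rewrite cE sqr_ge0.
  by rewrite pmulr_rge0.
have ar : -1 <= a / r <= 1.
  by move: b0; move: (a / r) => t ?; apply/andP; split; nra.
have ac : r * cos (acos (a / r)) = a.
  by rewrite acosK// mulrC divfK.
have bs : r * sin (acos (a / r)) = `|b|.
  by rewrite sin_acos// -[X in X * _](ger0_norm r0) -sqrtr_sqr -sqrtrM ?sqr_ge0// cE sqrtr_sqr.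
have [b_ge|b_lt] := leP 0 b.
  exists (acos (a / r)); last by rewrite ac bs ger0_norm.
  rewrite in_itv/= acos_ge0//= (le_trans (acos_lepi ar))// mulr2n.
  by rewrite lerDl ltW.
exists (pi *+ 2 - acos (a / r)).
  have := acos_ge0 ar; have := acos_lepi ar; rewrite in_itv/= mulr2n => ? ?.
  by apply/andP; split; lra.
have -> : cos (pi *+ 2 - acos (a / r)) = cos (acos (a / r)).
  by rewrite cosB cos2pi sin2pi mul1r mul0r addr0.
have -> : sin (pi *+ 2 - acos (a / r)) = - sin (acos (a / r)).
  by rewrite sinB cos2pi sin2pi mul1r mul0r sub0r.
by rewrite ac mulrN bs ltr0_norm// opprK.
Qed.

End Vec.

Section CapsuleGeometry.
Variables (R : realType) (x0 x5 : R).

Lemma max0l (t : R) : t <= 0 -> Num.max 0 t = 0.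
Proof. by move=> ?; rewrite max_l. Qed.

Lemma max0r (t : R) : 0 <= t -> Num.max 0 t = t.
Proof. by move=> ?; rewrite max_r. Qed.

(** The equation of the capsule is [axial x + (y^2 + z^2)^3 = 1]: taking the sixth
power of the profile merges its three branches into one function. *)
Definition axial (x : R) : R :=
  Num.max 0 (x0 - x) ^+ 6 + Num.max 0 (x - x5) ^+ 6.

Definition capsule_fun (z : 'rV[R]_3) : R :=
  axial (z 0 0) + (z 0 1 ^+ 2 + z 0 2%:R ^+ 2) ^+ 3 - 1.

Lemma root6K (t : R) : 0 <= t -> (t `^ 6%:R^-1) ^+ 6 = t.
Proof.
by move=> t0; rewrite -powR_mulrn ?powR_ge0// -powRrM mulVf ?powRr1// pnatr_eq0.
Qed.

Lemma powR6K (t : R) : 0 <= t -> (t ^+ 6) `^ 6%:R^-1 = t.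
Proof.
by move=> t0; rewrite -powR_mulrn// -powRrM mulfV ?powRr1// pnatr_eq0.
Qed.

Lemma maxX_ge0 n (t : R) : 0 <= Num.max 0 t ^+ n.
Proof. by rewrite exprn_ge0// le_max lexx. Qed.

Lemma axial_ge0 x : 0 <= axial x.
Proof. by rewrite addr_ge0// maxX_ge0. Qed.

Lemma w0E (x05 : x0 < x5) x : w0 x0 x5 x = (1 - axial x) `^ 6%:R^-1.
Proof.
rewrite /w0 /axial; case: ifPn => [xx0|]; last rewrite -ltNge => xx0.
  rewrite [Num.max 0 (x0 - x)]max0r ?subr_ge0// [Num.max 0 _]max0l; last by lra.
  by rewrite expr0n addr0.
rewrite [Num.max 0 (x0 - x)]max0l; last by lra.
rewrite expr0n add0r; case: ifPn => [xx5|]; last rewrite -ltNge => xx5.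
  rewrite [Num.max 0 _]max0l; last by lra.
  by rewrite expr0n subr0 powR1.
by rewrite max0r// subr_ge0 ltW.
Qed.

(** At most one of the two positive parts is nonzero, so the sum is below 1 as soon
as each term is. *)
Lemma axial_lt1 (x05 : x0 < x5) x : (axial x < 1) = (x0 - 1 < x < x5 + 1).
Proof.
have ltX (t : R) : (Num.max 0 t ^+ 6 < 1) = (t < 1).
  rewrite expr_lt1// ?le_max ?lexx// gt_max ltr01//.
rewrite /axial; have [xx0|xx0] := ltP x x0.
  rewrite [X in _ + X](_ : _ = 0) ?addr0 ?ltX; last first.
    by rewrite max0l ?expr0n//; lra.
  by apply/idP/andP => [?|[? ?]]; [split|]; lra.
rewrite [X in X + _](_ : _ = 0) ?add0r ?ltX; last first.
  by rewrite max0l ?expr0n//; lra.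
by apply/idP/andP => [?|[? ?]]; [split|]; lra.
Qed.

Lemma axial_le1 (x05 : x0 < x5) x : (axial x <= 1) = (x0 - 1 <= x <= x5 + 1).
Proof.
have leX (t : R) : (Num.max 0 t ^+ 6 <= 1) = (t <= 1).
  rewrite expr_le1// ?le_max ?lexx// ge_max ler01//.
rewrite /axial; have [xx0|xx0] := ltP x x0.
  rewrite [X in _ + X](_ : _ = 0) ?addr0 ?leX; last first.
    by rewrite max0l ?expr0n//; lra.
  by apply/idP/andP => [?|[? ?]]; [split|]; lra.
rewrite [X in X + _](_ : _ = 0) ?add0r ?leX; last first.
  by rewrite max0l ?expr0n//; lra.
by apply/idP/andP => [?|[? ?]]; [split|]; lra.
Qed.

Lemma axial0 x : x0 <= x <= x5 -> axial x = 0.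
Proof. by move=> /andP[? ?]; rewrite /axial !max0l ?expr0n ?addr0//; lra. Qed.

Lemma capsule_fun_revol (x05 : x0 < x5) x phi : x \in `[x0 - 1, x5 + 1] -> capsule_fun (revol x0 x5 x phi) = 0.
Proof.
rewrite in_itv/= -(axial_le1 x05) => hx; rewrite /capsule_fun -[revol _ _ _ _]/(vec3 _ _ _) !vec3E.
rewrite !exprMn -mulrDr cos2Dsin2 mulr1 -exprM (w0E x05) root6K ?subr_ge0//.
by ring.
Qed.

Lemma capsuleE (x05 : x0 < x5) : capsule x0 x5 = [set z | capsule_fun z = 0].
Proof.
apply/seteqP; split=> [z|z Fz].
  by move=> [x xI [phi _ <-]]; exact: (capsule_fun_revol x05).
have [phi phiI [yE zE]] := polar (z 0 1) (z 0 2%:R).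
set r := Num.sqrt _ in yE zE.
have r0 : 0 <= r by exact: sqrtr_ge0.
have r2 : r ^+ 2 = z 0 1 ^+ 2 + z 0 2%:R ^+ 2.
  by rewrite sqr_sqrtr// addr_ge0// sqr_ge0.
have r6 : r ^+ 6 = 1 - axial (z 0 0).
  by move: Fz; rewrite /= /capsule_fun -r2 -exprM /= => ?; lra.
have hx : axial (z 0 0) <= 1 by have := exprn_ge0 6 r0; rewrite r6 subr_ge0.
exists (z 0 0); first by rewrite /= in_itv/= -(axial_le1 x05).
exists phi => //; have w0r : w0 x0 x5 (z 0 0) = r by rewrite (w0E x05) -r6 powR6K.
by rewrite -[revol _ _ _ _]/(vec3 _ _ _); apply: row3P; rewrite vec3E// w0r.
Qed.

Lemma ck1_axial k : (k <= 5)%N -> ck1 k setT axial.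
Proof.
move=> k5; apply: ckW k5 _; apply: ckD.
  apply: (@ck_comp _ _ _ _ 5 setT setT (fun t : R => Num.max 0 t ^+ 6)
    (fun x => x0 - x)) => //; first exact: ck1_maxX.
  by apply: ckD; [exact: ck_cst|apply: ckN; exact: (@ck1_id R 5 setT)].
apply: (@ck_comp _ _ _ _ 5 setT setT (fun t : R => Num.max 0 t ^+ 6)
    (fun x => x - x5)) => //; first exact: ck1_maxX.
by apply: ckD; [exact: (@ck1_id R 5 setT)|exact: ck_cst].
Qed.

Lemma ck1_w0 (x05 : x0 < x5) : ck1 5 [set x | x0 - 1 < x < x5 + 1] (w0 x0 x5).
Proof.
rewrite (funext (w0E x05)).
apply: (@ck_comp _ _ _ _ 5 [set x | 0 < x] _ (fun t : R => t `^ 6%:R^-1)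
  (fun x => 1 - axial x)); first exact: ck1_powR.
  by apply: ckD; [exact: ck_cst|apply: ckN; exact: ck_sub (ck1_axial _)].
by move=> x /=; rewrite subr_gt0 (axial_lt1 x05).
Qed.

Lemma w0_gt0 (x05 : x0 < x5) x : x0 - 1 < x < x5 + 1 -> 0 < w0 x0 x5 x.
Proof. by move=> xI; rewrite (w0E x05) powR_gt0// subr_gt0 (axial_lt1 x05). Qed.

Lemma w0_pow6 (x05 : x0 < x5) x : x0 - 1 <= x <= x5 + 1 -> w0 x0 x5 x ^+ 6 = 1 - axial x.
Proof. by move=> xI; rewrite (w0E x05) root6K// subr_ge0 (axial_le1 x05). Qed.

End CapsuleGeometry.

(** * Charts around the axis *)

Section Tools.
Variable R : realType.

Lemma open_ltf (T : topologicalType) (f g : T -> R) :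
  continuous f -> continuous g -> open [set p | f p < g p].
Proof.
move=> cf cg; rewrite (_ : mkset _ = (fun p => g p - f p) @^-1` [set y | 0 < y]).
  apply: open_comp; last exact: open_gt.
  by move=> p _; apply: cvgB; [exact: cg|exact: cf].
by apply/seteqP; split=> p /=; rewrite subr_gt0.
Qed.

Lemma cont_add (T : topologicalType) (f g : T -> R) :
  continuous f -> continuous g -> continuous (fun x => f x + g x).
Proof. by move=> cf cg x; apply: cvgD; [exact: cf|exact: cg]. Qed.

Lemma cont_sub (T : topologicalType) (f g : T -> R) :
  continuous f -> continuous g -> continuous (fun x => f x - g x).
Proof. by move=> cf cg x; apply: cvgB; [exact: cf|exact: cg]. Qed.

Lemma cont_mul (T : topologicalType) (f g : T -> R) :
  continuous f -> continuous g -> continuous (fun x => f x * g x).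
Proof. by move=> cf cg x; apply: cvgM; [exact: cf|exact: cg]. Qed.

Lemma cont_exp n (T : topologicalType) (f : T -> R) :
  continuous f -> continuous (fun x => f x ^+ n).
Proof.
by move=> cf x; apply: (@continuous_comp _ _ _ f (fun y => y ^+ n));
  [exact: cf|exact: exprn_continuous].
Qed.

Lemma cont_atan_div (T : topologicalType) (f g : T -> R) c z :
  continuous f -> continuous g -> g z != 0 ->
  {for z, continuous (fun x => c + atan (f x / g x))}.
Proof.
move=> cf cg gz; apply: cvgD; first exact: cvg_cst.
apply: (cvg_comp (fun x => f x / g x) (@atan R)); last exact: continuous_atan.
by apply: cvgM; [exact: cf|apply: cvgV; [exact: gz|exact: cg]].
Qed.

Definition row2 (a b : R) : 'rV[R]_2 := \row_j [:: a; b]`_j.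

Lemma row2E a b : ((row2 a b 0 0 = a) * (row2 a b 0 1 = b))%type.
Proof. by rewrite !mxE. Qed.

Lemma row2P (v w : 'rV[R]_2) : v 0 0 = w 0 0 -> v 0 1 = w 0 1 -> v = w.
Proof. by move=> *; apply/rowP; exact: ord2_ind. Qed.

Lemma cvg_row2 (T : topologicalType) (f g : T -> R) z :
  {for z, continuous f} -> {for z, continuous g} ->
  {for z, continuous (fun x => row2 (f x) (g x))}.
Proof.
move=> cf cg; apply: cvg_row; apply: ord2_ind; rewrite row2E.
  by under eq_fun do rewrite row2E.
by under eq_fun do rewrite row2E.
Qed.

Lemma cvg_vec3 (T : topologicalType) (f g h : T -> R) z :
  {for z, continuous f} -> {for z, continuous g} -> {for z, continuous h} ->
  {for z, continuous (fun x => vec3 (f x) (g x) (h x))}.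
Proof.
move=> cf cg ch; apply: cvg_row; apply: ord3_ind; rewrite vec3E.
- by under eq_fun do rewrite vec3E.
- by under eq_fun do rewrite vec3E.
- by under eq_fun do rewrite vec3E.
Qed.

Lemma ck2_vec3 k U (gam : 'rV[R]_2 -> 'rV[R]_3) :
  ck2 k U (fun p => gam p 0 0) -> ck2 k U (fun p => gam p 0 1) ->
  ck2 k U (fun p => gam p 0 2%:R) -> ck2 k U gam.
Proof.
move=> c0 c1 c2; apply/ck_row.
exact: (@ord3_ind (fun j => ck2 k U (fun p => gam p 0 j))).
Qed.

Lemma ck2_coord_comp k D U j (f : R -> R) :
  ck1 k D f -> (forall p : 'rV[R]_2, U p -> D (p 0 j)) ->
  ck2 k U (fun p => f (p 0 j)).
Proof.
move=> cf UD.
exact: (@ck_comp R 'rV[R]_2 'I_2 (delta_mx 0) k D U f (fun p => p 0 j) cf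
  (@ck2_coord R k U j)).
Qed.

Lemma row_free2 (v0 v1 : 'rV[R]_3) (M : 'I_2 -> 'rV[R]_3) :
  M 0 = v0 -> M 1 = v1 ->
  (forall a b, a *: v0 + b *: v1 = 0 -> a = 0 /\ b = 0) ->
  row_free (\matrix_(i < 2) M i).
Proof.
move=> M0 M1 free; apply: inj_row_free => v vM.
have : v 0 0 *: v0 + v 0 1 *: v1 = 0.
  by rewrite -vM mulmx_sum_row sum_ord2 !rowK M0 M1.
by move=> /free[v00 v01]; apply: row2P; rewrite ?v00 ?v01 mxE.
Qed.

End Tools.

Section TubeChart.
Variables (R : realType) (x0 x5 : R).

Definition tube (p : 'rV[R]_2) := revol x0 x5 (p 0 0) (p 0 1).

Lemma tubeE p : tube p = vec3 (p 0 0) (w0 x0 x5 (p 0 0) * cos (p 0 1))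
  (w0 x0 x5 (p 0 0) * sin (p 0 1)).
Proof. by []. Qed.

(** A chart domain with angles in an open half turn around [phi0], so that the angle
is recovered by an arc tangent. *)
Definition tube_dom (phi0 : R) : set 'rV[R]_2 :=
  [set p | x0 - 1 < p 0 0 < x5 + 1 /\ phi0 - pi / 2 < p 0 1 < phi0 + pi / 2].

Lemma open_tube_dom phi0 : open (tube_dom phi0).
Proof.
have cc (j : 'I_2) : continuous (fun p : 'rV[R]_2 => p 0 j).
  exact: coord_continuous.
rewrite (_ : tube_dom _ = ([set p | x0 - 1 < p 0 0] `&` [set p | p 0 0 < x5 + 1])
  `&` ([set p | phi0 - pi / 2 < p 0 1] `&` [set p | p 0 1 < phi0 + pi / 2])).
  by do 2?apply: openI; apply: open_ltf => //; exact: cst_continuous.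
apply/seteqP; split=> p /=.
  by move=> [/andP[? ?] /andP[? ?]].
by move=> [[? ?] [? ?]]; split; apply/andP.
Qed.

Lemma pd_tube (p : 'rV[R]_2) (dw : R) : is_derive (p 0 0) 1 (w0 x0 x5) dw ->
  pd 0 tube p = vec3 1 (dw * cos (p 0 1)) (dw * sin (p 0 1)) /\
  pd 1 tube p = vec3 0 (- (w0 x0 x5 (p 0 0) * sin (p 0 1)))
                       (w0 x0 x5 (p 0 0) * cos (p 0 1)).
Proof.
move=> hw.
have dW i : is_derive p (delta_mx 0 i) (fun q : 'rV[R]_2 => w0 x0 x5 (q 0 0))
    (dw * (i == 0)%:R).
  exact: (is_derive_chain (h := fun q : 'rV[R]_2 => q 0 0) hw (pd_coord i 0 p)).
have dC i : is_derive p (delta_mx 0 i) (fun q : 'rV[R]_2 => cos (q 0 1))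
    (- sin (p 0 1) * (i == 1)%:R).
  exact: (is_derive_chain (h := fun q : 'rV[R]_2 => q 0 1) (is_derive_cos _) (pd_coord i 1 p)).
have dS i : is_derive p (delta_mx 0 i) (fun q : 'rV[R]_2 => sin (q 0 1))
    (cos (p 0 1) * (i == 1)%:R).
  exact: (is_derive_chain (h := fun q : 'rV[R]_2 => q 0 1) (is_derive_sin _) (pd_coord i 1 p)).
have dWC i := is_deriveM (dW i) (dC i).
have dWS i := is_deriveM (dW i) (dS i).
have E0 : (fun q => tube q 0 0) = (fun q : 'rV[R]_2 => q 0 0).
  by apply/funext => q; rewrite tubeE vec3E.
have E1 : (fun q => tube q 0 1) =
    (fun q : 'rV[R]_2 => w0 x0 x5 (q 0 0)) * (fun q => cos (q 0 1)).
  by apply/funext => q; rewrite tubeE vec3E.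
have E2 : (fun q => tube q 0 2%:R) =
    (fun q : 'rV[R]_2 => w0 x0 x5 (q 0 0)) * (fun q => sin (q 0 1)).
  by apply/funext => q; rewrite tubeE vec3E.
split.
  apply: pd_row3.
  - by rewrite E0; exact: (pd_coord 0 0 p).
  - rewrite E1; apply: is_derive_eq (dWC 0) _.
    by rewrite /GRing.scale/= mulr0 mulr0 add0r mulr1 mulrC.
  - rewrite E2; apply: is_derive_eq (dWS 0) _.
    by rewrite /GRing.scale/= mulr0 mulr0 add0r mulr1 mulrC.
apply: pd_row3.
- by rewrite E0; exact: (pd_coord 1 0 p).
- rewrite E1; apply: is_derive_eq (dWC 1) _.
  by rewrite /GRing.scale/= mulr0 mulr0 addr0 mulr1 mulrN.
- rewrite E2; apply: is_derive_eq (dWS 1) _.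
  by rewrite /GRing.scale/= mulr0 mulr0 addr0 mulr1.
Qed.

Lemma ck2_tube (x05 : x0 < x5) phi0 : ck2 5 (tube_dom phi0) tube.
Proof.
have cw : ck2 5 (tube_dom phi0) (fun q : 'rV[R]_2 => w0 x0 x5 (q 0 0)).
  by apply: (ck2_coord_comp (ck1_w0 x05)) => p [].
have ct (f : R -> R) : ck1 5 setT f ->
    ck2 5 (tube_dom phi0) (fun q : 'rV[R]_2 => f (q 0 1)).
  by move=> cf; exact: (ck2_coord_comp cf).
have [cs cc] := ck1_sincos 5 [set: R].
apply: ck2_vec3.
- by under eq_fun do rewrite tubeE vec3E; exact: ck2_coord.
- by under eq_fun do rewrite tubeE vec3E; apply: ckM => //; exact: ct.
- by under eq_fun do rewrite tubeE vec3E; apply: ckM => //; exact: ct.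
Qed.

Lemma immersion_tube (x05 : x0 < x5) phi0 : immersion (tube_dom phi0) tube.
Proof.
move=> p [px _]; have [_ /(_ tt)[w' dw _]] := ck1_w0 x05.
have [e0 e1] := pd_tube (dw _ px).
apply: (row_free2 e0 e1) => a b ab.
have /(congr1 (fun v : 'rV[R]_3 => v 0 0)) := ab.
have /(congr1 (fun v : 'rV[R]_3 => v 0 1)) := ab.
have /(congr1 (fun v : 'rV[R]_3 => v 0 2%:R)) := ab.
rewrite !mxE /= mulr1 mulr0 addr0 => h2 h1 a0; split=> //.
move: h1 h2; rewrite a0 !mul0r !add0r.
have := w0_gt0 x05 px; set w := w0 _ _ _ => wgt0.
have := cos2Dsin2 (p 0 1); set c := cos _; set s := sin _ => cs h1 h2.
have : b * w = 0.
  rewrite -[b * w]mulr1 -cs.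
  have -> : b * w * (c ^+ 2 + s ^+ 2) = c * (b * (w * c)) - s * (b * - (w * s)).
    by ring.
  by rewrite h1 h2; ring.
by move/eqP; rewrite mulf_eq0 (gt_eqF wgt0) orbF => /eqP.
Qed.

Let Yc phi0 (z : 'rV[R]_3) := z 0 1 * cos phi0 + z 0 2%:R * sin phi0.
Let Zc phi0 (z : 'rV[R]_3) := z 0 2%:R * cos phi0 - z 0 1 * sin phi0.

(** Turning the [(y, z)] plane by [-phi0] brings the piece of surface into the half
plane [Y > 0], where the angle is [phi0 + atan (Z / Y)]. *)
Lemma local_param_tube (x05 : x0 < x5) phi0 :
  local_param (capsule x0 x5) (tube_dom phi0) tube.
Proof.
have cc (j : 'I_3) : continuous (fun p : 'rV[R]_3 => p 0 j).
  exact: coord_continuous.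
have cY : continuous (Yc phi0).
  by apply: cont_add; apply: cont_mul => //; exact: cst_continuous.
have cZ : continuous (Zc phi0).
  by apply: cont_sub; apply: cont_mul => //; exact: cst_continuous.
have sc1 := cos2Dsin2 phi0.
have pi2 : 0 < pi / 2 :> R by rewrite divr_gt0// pi_gt0.
pose psi (z : 'rV[R]_3) := row2 (z 0 0) (phi0 + atan (Zc phi0 z / Yc phi0 z)).
pose W := ([set z : 'rV[R]_3 | x0 - 1 < z 0 0] `&` [set z | z 0 0 < x5 + 1])
  `&` [set z | 0 < Yc phi0 z].
apply: (@local_param_of_inverse R _ W _ _ psi).
- exact: open_tube_dom.
- by apply/CkP; [exact: open_tube_dom|exact: ck2_tube].
- exact: immersion_tube.
- by do 2?apply: openI; apply: open_ltf => //; exact: cst_continuous.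
- move=> p [px pphi].
  have wgt0 := w0_gt0 x05 px.
  have YE : Yc phi0 (tube p) = w0 x0 x5 (p 0 0) * cos (p 0 1 - phi0).
    by rewrite /Yc tubeE !vec3E cosB; ring.
  have ZE : Zc phi0 (tube p) = w0 x0 x5 (p 0 0) * sin (p 0 1 - phi0).
    by rewrite /Zc tubeE !vec3E sinB; ring.
  have dphi : - (pi / 2) < p 0 1 - phi0 < pi / 2.
    by move/andP: pphi => [? ?]; apply/andP; split; lra.
  have cgt0 : 0 < cos (p 0 1 - phi0) by exact: cos_gt0_pihalf.
  have /andP[px1 px2] := px; split.
  + rewrite capsuleE//; apply: (capsule_fun_revol x05).
    by rewrite in_itv/= !ltW.
  + split; [split|] => //=; rewrite ?tubeE ?vec3E//.
    by rewrite -tubeE YE mulr_gt0.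
  + apply: row2P; rewrite row2E ?tubeE ?vec3E// -tubeE YE ZE.
    rewrite -mulf_div divff ?gt_eqF// mul1r -/(tan _) tanK; first by ring.
    by rewrite in_itv.
- move=> z [_ Yz]; apply: cvg_row2; first exact: cc.
  by apply: cont_atan_div => //; rewrite gt_eqF.
- move=> z Sz [[zx1 zx2] Yz].
  have zx : x0 - 1 < z 0 0 < x5 + 1 by rewrite zx1.
  split.
    split; rewrite row2E//.
    by have := atan_gtNpi2 (Zc phi0 z / Yc phi0 z);
       have := atan_ltpi2 (Zc phi0 z / Yc phi0 z) => ? ?; apply/andP; split; lra.
  have Yz0 : 0 < Yc phi0 z by [].
  move: Sz; rewrite (capsuleE x05) => Fz.
  have wgt0 := w0_gt0 x05 zx.
  have w2 : w0 x0 x5 (z 0 0) ^+ 2 = Yc phi0 z ^+ 2 + Zc phi0 z ^+ 2.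
    have -> : Yc phi0 z ^+ 2 + Zc phi0 z ^+ 2 = z 0 1 ^+ 2 + z 0 2%:R ^+ 2.
      rewrite -[RHS]mulr1 -sc1 /Yc /Zc; ring.
    apply/eqP; rewrite -(@eqrXn2 _ 3)// ?sqr_ge0 ?addr_ge0 ?sqr_ge0//.
    rewrite -exprM w0_pow6 ?(ltW zx1) ?(ltW zx2)//; apply/eqP.
    by move: Fz; rewrite /= /capsule_fun; lra.
  set t := Zc phi0 z / Yc phi0 z.
  have ct : w0 x0 x5 (z 0 0) * cos (atan t) = Yc phi0 z.
    rewrite cos_atan.
    have -> : w0 x0 x5 (z 0 0) = Yc phi0 z * Num.sqrt (1 + t ^+ 2).
      rewrite -[LHS](ger0_norm (ltW wgt0)) -sqrtr_sqr w2.
      rewrite -[X in _ = X * _](ger0_norm (ltW Yz0)) -sqrtr_sqr -sqrtrM ?sqr_ge0//.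
      by congr Num.sqrt; rewrite mulrDr mulr1 /t expr_div_n mulrCA mulfV ?mulr1// expf_neq0// gt_eqF.
    rewrite mulfK// gt_eqF// sqrtr_gt0 ltr_pwDl ?sqr_ge0//.
  have st : w0 x0 x5 (z 0 0) * sin (atan t) = Zc phi0 z.
    have -> : sin (atan t) = t * cos (atan t).
      by rewrite -[t in t * _]atanK /tan divfK// gt_eqF// cos_gt0_pihalf// atan_gtNpi2 atan_ltpi2.
    by rewrite mulrCA ct /t divfK// gt_eqF.
  rewrite tubeE; apply: row3P; rewrite !vec3E /psi !row2E//.
    rewrite cosD mulrBr -/t !mulrA.
    rewrite [w0 _ _ _ * cos phi0]mulrC [w0 _ _ _ * sin phi0]mulrC -!mulrA ct st.
    by rewrite -[RHS]mulr1 -sc1 /Yc /Zc; ring.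
  rewrite sinD mulrDr -/t !mulrA.
  rewrite [w0 _ _ _ * cos phi0]mulrC [w0 _ _ _ * sin phi0]mulrC -!mulrA ct st.
  by rewrite -[RHS]mulr1 -sc1 /Yc /Zc; ring.
Qed.

End TubeChart.

(** * Charts at the poles, compactness and connectedness *)

Section CapChart.
Variables (R : realType) (x0 x5 : R).

Definition disc : set 'rV[R]_2 := [set p | p 0 0 ^+ 2 + p 0 1 ^+ 2 < 1].

Definition cap_height (p : 'rV[R]_2) : R :=
  (1 - (p 0 0 ^+ 2 + p 0 1 ^+ 2) ^+ 3) `^ 6%:R^-1.

(** Near a pole the capsule is a graph over the [(y, z)] disc; the sign [s] selects
the left cap ([a = x0], [s = -1]) or the right one ([a = x5], [s = 1]). *)
Definition capchart (a s : R) (p : 'rV[R]_2) : 'rV[R]_3 :=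
  vec3 (a + s * cap_height p) (p 0 0) (p 0 1).

Lemma open_disc : open disc.
Proof.
apply: open_ltf; last exact: cst_continuous.
by apply: cont_add; apply: cont_exp; exact: coord_continuous.
Qed.

Lemma disc_pow (p : 'rV[R]_2) :
  ((p 0 0 ^+ 2 + p 0 1 ^+ 2) ^+ 3 < 1) = (p 0 0 ^+ 2 + p 0 1 ^+ 2 < 1).
Proof. by rewrite expr_lt1// addr_ge0// sqr_ge0. Qed.

Lemma cap_height_pow6 p : disc p ->
  cap_height p ^+ 6 = 1 - (p 0 0 ^+ 2 + p 0 1 ^+ 2) ^+ 3.
Proof. by move=> dp; rewrite root6K// subr_ge0 ltW// disc_pow. Qed.

Lemma cap_height_gt0 p : disc p -> 0 < cap_height p.
Proof. by move=> dp; rewrite powR_gt0// subr_gt0 disc_pow. Qed.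

Lemma ck2_cap_height k : ck2 k disc cap_height.
Proof.
apply: (@ck_comp R 'rV[R]_2 'I_2 (delta_mx 0) k [set x | 0 < x] disc
  (fun t : R => t `^ 6%:R^-1)
  (fun p => 1 - (p 0 0 ^+ 2 + p 0 1 ^+ 2) ^+ 3)); first exact: ck1_powR.
  apply: ckD; first exact: ck_cst.
  by apply: ckN; apply: ckX; apply: ckD; apply: ckX; exact: ck2_coord.
by move=> p dp; rewrite /= subr_gt0 disc_pow.
Qed.

Lemma local_param_cap (x05 : x0 < x5) a s : s ^+ 2 = 1 ->
  (forall x, 0 < s * (x - a) -> axial x0 x5 x = (s * (x - a)) ^+ 6) ->
  local_param (capsule x0 x5) disc (capchart a s).
Proof.
move=> s2 Ha.
have s0 : s != 0 by apply/eqP => s0; move: s2; rewrite s0 expr0n => /eqP; rewrite eq_sym oner_eq0.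
have kgam : ck2 5 disc (capchart a s).
  apply: ck2_vec3.
  - under eq_fun do rewrite vec3E.
    apply: ckD; first exact: ck_cst.
    by apply: ckM; [exact: ck_cst|exact: (@ck2_cap_height 5)].
  - by under eq_fun do rewrite vec3E; exact: ck2_coord.
  - by under eq_fun do rewrite vec3E; exact: ck2_coord.
apply: (@local_param_of_inverse R _ [set z | 0 < s * (z 0 0 - a)] _ _
  (fun z => row2 (z 0 1) (z 0 2%:R))).
- exact: open_disc.
- by apply/CkP => //; exact: open_disc.
- move=> p dp.
  have /ck_row/(_ 0)[_ dh] := kgam.
  have [k0 dk0 _] := dh 0; have [k1 dk1 _] := dh 1.
  have E1 : (fun q => capchart a s q 0 1) = (fun q => q 0 0).
    by apply/funext => q; rewrite vec3E.
  have E2 : (fun q => capchart a s q 0 2%:R) = (fun q => q 0 1).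
    by apply/funext => q; rewrite vec3E.
  have e0 : pd 0 (capchart a s) p = vec3 (k0 p) 1 0.
    apply: pd_row3; first exact: dk0.
      by rewrite E1; exact: (pd_coord 0 0 p).
    by rewrite E2; exact: (pd_coord 0 1 p).
  have e1 : pd 1 (capchart a s) p = vec3 (k1 p) 0 1.
    apply: pd_row3; first exact: dk1.
      by rewrite E1; exact: (pd_coord 1 0 p).
    by rewrite E2; exact: (pd_coord 1 1 p).
  apply: (row_free2 e0 e1) => u v uv.
  have /(congr1 (fun v : 'rV[R]_3 => v 0 1)) := uv.
  have /(congr1 (fun v : 'rV[R]_3 => v 0 2%:R)) := uv.
  by rewrite !mxE /= !mulr1 !mulr0 addr0 add0r.
- apply: open_ltf; first exact: cst_continuous.
  apply: cont_mul; first exact: cst_continuous.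
  by apply: cont_sub; [exact: coord_continuous|exact: cst_continuous].
- move=> p dp.
  have E : s * (a + s * cap_height p - a) = cap_height p.
    by rewrite addrAC subrr add0r mulrA -expr2 s2 mul1r.
  have hgt := cap_height_gt0 dp; split.
  + rewrite capsuleE//= /capsule_fun !vec3E Ha E// cap_height_pow6//; ring.
  + by rewrite /= vec3E E.
  + by apply: row2P; rewrite row2E vec3E.
- by move=> z _; apply: cvg_row2; exact: coord_continuous.
- move=> z; rewrite capsuleE//= /capsule_fun => Fz Wz; rewrite Ha// in Fz.
  have h6 : (s * (z 0 0 - a)) ^+ 6 = 1 - (z 0 1 ^+ 2 + z 0 2%:R ^+ 2) ^+ 3 by lra.
  have hgt : 0 < (s * (z 0 0 - a)) ^+ 6 by exact: exprn_gt0.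
  split; first by rewrite /disc/= -disc_pow !row2E -subr_gt0 -h6.
  apply: row3P; rewrite vec3E ?row2E//.
  rewrite /cap_height !row2E -h6 powR6K ?ltW// mulrA -expr2 s2 mul1r.
  by rewrite addrC subrK.
Qed.

Lemma local_param_left (x05 : x0 < x5) :
  local_param (capsule x0 x5) disc (capchart x0 (-1)).
Proof.
apply: (local_param_cap x05); first by rewrite sqrrN expr1n.
move=> x xx0; rewrite /axial [X in _ + X](_ : _ = 0); last first.
  by rewrite max0l ?expr0n//; lra.
by rewrite addr0 max0r; [congr (_ ^+ _)|]; lra.
Qed.

Lemma local_param_right (x05 : x0 < x5) :
  local_param (capsule x0 x5) disc (capchart x5 1).
Proof.
apply: (local_param_cap x05); first by rewrite expr1n.
move=> x xx0; rewrite /axial [X in X + _](_ : _ = 0); last first.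
  by rewrite max0l ?expr0n//; lra.
by rewrite add0r max0r; [congr (_ ^+ _)|]; lra.
Qed.

Lemma capsule_charts (x05 : x0 < x5) z : capsule x0 x5 z ->
  exists U gam, local_param (capsule x0 x5) U gam /\ (gam @` U) z.
Proof.
move=> [x /= xI [phi _ <-]].
have pi2 : 0 < pi / 2 :> R by rewrite divr_gt0// pi_gt0.
have hx : axial x0 x5 x <= 1 by rewrite axial_le1//; rewrite in_itv in xI.
have disc0 : disc (row2 0 0) by rewrite /disc/= !row2E expr0n addr0.
have h0 : cap_height (row2 0 0) = 1.
  by rewrite /cap_height !row2E expr0n/= addr0 expr0n subr0 powR1.
move: hx; rewrite le_eqVlt => /orP[/eqP hx|hx]; last first.
  exists (tube_dom x0 x5 phi), (tube x0 x5); split; first exact: local_param_tube.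
  exists (row2 x phi); last by rewrite tubeE !row2E.
  split; rewrite row2E; first by rewrite -axial_lt1.
  by apply/andP; split; lra.
have wx : w0 x0 x5 x = 0 by rewrite w0E// hx subrr powR0.
have {xI} : (x == x0 - 1) || (x == x5 + 1).
  move: (axial_lt1 x05 x) xI; rewrite hx ltxx in_itv/= => /esym/negbT.
  rewrite negb_and -!leNgt => /orP[? /andP[? ?]|? /andP[? ?]].
    by apply/orP; left; rewrite eq_le; apply/andP.
  by apply/orP; right; rewrite eq_le; apply/andP.
move=> /orP[/eqP xE|/eqP xE].
  exists disc, (capchart x0 (-1)); split; first exact: local_param_left.
  exists (row2 0 0) => //; rewrite -[revol _ _ _ _]/(vec3 _ _ _) wx !mul0r.
  by rewrite /capchart h0 !row2E mulr1 xE.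
exists disc, (capchart x5 1); split; first exact: local_param_right.
exists (row2 0 0) => //; rewrite -[revol _ _ _ _]/(vec3 _ _ _) wx !mul0r.
by rewrite /capchart h0 !row2E mulr1 xE.
Qed.

End CapChart.

Section Topology.
Variables (R : realType) (x0 x5 : R).

Lemma continuous_axial : continuous (axial x0 x5).
Proof. by move=> x; exact: (ck_cont (@ck1_axial R x0 x5 0 isT)). Qed.

Lemma continuous_capsule_fun : continuous (capsule_fun x0 x5).
Proof.
have cc (j : 'I_3) : continuous (fun p : 'rV[R]_3 => p 0 j).
  exact: coord_continuous.
apply: cont_sub; last exact: cst_continuous.
apply: cont_add.
  move=> z; apply: (@continuous_comp _ _ _ (fun z : 'rV[R]_3 => z 0 0) (axial x0 x5)).
    exact: cc.
  exact: continuous_axial.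
by apply: cont_exp; apply: cont_add; apply: cont_exp.
Qed.

Lemma capsule_compact (x05 : x0 < x5) : compact (capsule x0 x5).
Proof.
pose a (j : 'I_3) : R := if j == 0 then x0 - 1 else -1.
pose b (j : 'I_3) : R := if j == 0 then x5 + 1 else 1.
apply: (@subclosed_compact _ _ [set v : 'rV[R]_3 | forall j, `[a j, b j]%classic (v 0 j)]).
- rewrite capsuleE//; apply: (@closed_comp _ _ (capsule_fun x0 x5) [set 0]).
    by move=> z _; exact: continuous_capsule_fun.
  exact: closed_eq.
- apply: (@rV_compact R 3 (fun j => `[a j, b j]%classic)) => j.
  exact: segment_compact.
- move=> z; rewrite capsuleE//= /capsule_fun => Fz.
  have h0 := axial_ge0 x0 x5 (z 0 0).
  have r0 : 0 <= (z 0 1 ^+ 2 + z 0 2%:R ^+ 2) ^+ 3.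
    by rewrite exprn_ge0// addr_ge0// sqr_ge0.
  have : axial x0 x5 (z 0 0) <= 1 by lra.
  rewrite axial_le1// => zx.
  have : (z 0 1 ^+ 2 + z 0 2%:R ^+ 2) ^+ 3 <= 1 by lra.
  rewrite expr_le1 ?addr_ge0 ?sqr_ge0// => r1.
  have y1 : z 0 1 ^+ 2 <= 1 by have := sqr_ge0 (z 0 2%:R); lra.
  have z1 : z 0 2%:R ^+ 2 <= 1 by have := sqr_ge0 (z 0 1); lra.
  apply: ord3_ind; rewrite /a /b /= in_itv//=.
    by apply/andP; split; nra.
  by apply/andP; split; nra.
Qed.

(** The truncation makes the sixth root continuous on the whole line, in particular
at 0, which is the value reached at the two poles. *)
Lemma continuous_root6 : continuous (fun t : R => Num.max 0 t `^ 6%:R^-1).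
Proof.
move=> t; have [t0|t0] := ltP 0 t.
  have c : {for t, continuous (fun t : R => t `^ 6%:R^-1)}.
    exact: (ck_cont (@ck1_powR R 0 6%:R^-1)).
  rewrite /continuous_at max0r ?ltW//; apply: cvg_trans c.
  apply: near_eq_cvg; near=> u; rewrite max0r// ltW//.
  by near: u; exact: lt_nbhsr.
rewrite /continuous_at (max0l t0) powR0 ?invr_eq0 ?pnatr_eq0//.
apply/cvgr0Pnorm_lt => e e0; near=> u.
have ue : u < e ^+ 6.
  near: u; apply: lt_nbhsl; apply: le_lt_trans t0 _; exact: exprn_gt0.
rewrite ger0_norm ?powR_ge0// -[ltRHS](powR6K (ltW e0)).
apply: gt0_ltr_powR; rewrite ?invr_gt0// ?nnegrE ?le_max ?lexx ?exprn_ge0 ?(ltW e0)//.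
by rewrite gt_max exprn_gt0.
Unshelve. all: by end_near. Qed.

(** The capsule is the union of its latitude circles, each of them joined to the
others by one meridian. *)
Lemma capsule_connected (x05 : x0 < x5) : connected (capsule x0 x5).
Proof.
pose w x := Num.max 0 (1 - axial x0 x5 x) `^ 6%:R^-1.
have cw : continuous w.
  move=> x; apply: (@continuous_comp _ _ _ (fun x => 1 - axial x0 x5 x)
    (fun t : R => Num.max 0 t `^ 6%:R^-1)); last exact: continuous_root6.
  by apply: cont_sub; [exact: cst_continuous|exact: continuous_axial].
have wE x : x \in `[x0 - 1, x5 + 1] -> w x = w0 x0 x5 x.
  by rewrite in_itv/= -axial_le1// => hx; rewrite w0E// /w max0r// subr_ge0.
pose I := `[x0 - 1, x5 + 1]%classic.
pose L := (fun x => vec3 (x) (w x * cos 0) (w x * sin 0)) @` I.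
pose C x := (fun phi => vec3 x (w x * cos phi) (w x * sin phi)) @` `[0, pi *+ 2]%classic.
have pi0 : 0 <= (pi : R) *+ 2 by rewrite mulrn_wge0// ltW// pi_gt0.
have -> : capsule x0 x5 = \bigcup_(x in I) (L `|` C x).
  apply/seteqP; split=> z.
    move=> [x /= xI [phi /= phiI <-]]; exists x => //; right.
    by exists phi => //; rewrite wE.
  move=> [x /= xI [[y /= yI <-]|[phi /= phiI <-]]].
    exists y => //; exists 0; first by rewrite /= in_itv/= lexx.
    by rewrite wE.
  by exists x => //; exists phi => //; rewrite wE.
have LI x : I x -> L (vec3 x (w x * cos 0) (w x * sin 0)) by exists x.
apply: bigcup_connected.
  exists (vec3 x0 (w x0 * cos 0) (w x0 * sin 0)) => x xI; left; apply: LI.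
  by rewrite /I/= in_itv/=; apply/andP; split; lra.
move=> x xI; apply: connectedU.
- exists (vec3 x (w x * cos 0) (w x * sin 0)); split; first exact: LI.
  by exists 0 => //=; rewrite in_itv/= lexx.
- apply: connected_continuous_connected; first exact: segment_connected.
  apply: continuous_subspaceT => y.
  apply: (@cvg_vec3 R R id (fun x => w x * cos 0) (fun x => w x * sin 0) y).
  - exact: cvg_id.
  - by apply: cont_mul => //; exact: cst_continuous.
  - by apply: cont_mul => //; exact: cst_continuous.
- apply: connected_continuous_connected; first exact: segment_connected.
  apply: continuous_subspaceT => y.
  apply: (@cvg_vec3 R R (cst x) (fun t => w x * cos t) (fun t => w x * sin t) y).
  - exact: cvg_cst.
  - by apply: cont_mul; [exact: cst_continuous|exact: continuous_cos].
  - by apply: cont_mul; [exact: cst_continuous|exact: continuous_sin].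
Qed.

End Topology.

(** * Unit normal and convexity of the capsule *)

Lemma cont_normalize (R : realType) (T : topologicalType) (V : normedModType R)
    (d : T -> R) (g : T -> V) z :
  continuous d -> {for z, continuous g} -> 0 < d z ->
  {for z, continuous (fun x => (Num.sqrt (d x))^-1 *: g x)}.
Proof.
move=> cd cg dz; apply: cvgZ; last exact: cg.
apply: cvgV; first by rewrite gt_eqF// sqrtr_gt0.
by apply: (@continuous_comp _ _ _ d Num.sqrt); [exact: cd|exact: sqrt_continuous].
Qed.

Lemma cvg_ray (R : realType) (V : normedModType R) (z d : V) :
  (fun e : R => z + e *: d) @ (0 : R) --> z.
Proof.
have c : {for (0 : R), continuous (fun e : R => z + e *: d)}.
  by apply: cvgD; [exact: cvg_cst|apply: cvgZ; [exact: cvg_id|exact: cvg_cst]].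
by rewrite /prop_for /continuous_at scale0r addr0 in c.
Qed.

Section Normal.
Variables (R : realType) (x0 x5 : R).

Definition daxial (x : R) : R :=
  6%:R * (Num.max 0 (x - x5) ^+ 5 - Num.max 0 (x0 - x) ^+ 5).

(** The gradient of [capsule_fun], normal to its level sets. *)
Definition capsule_grad (z : 'rV[R]_3) : 'rV[R]_3 :=
  let r2 := z 0 1 ^+ 2 + z 0 2%:R ^+ 2 in
  vec3 (daxial (z 0 0)) (6%:R * r2 ^+ 2 * z 0 1) (6%:R * r2 ^+ 2 * z 0 2%:R).

Lemma is_derive_axial (x : R) : is_derive x 1 (axial x0 x5) (daxial x).
Proof.
have d0 : is_derive x 1 (fun t : R => x0 - t) (-1).
  apply: is_derive_eq (is_deriveB (is_derive_cst x0 x 1) (is_derive_id x 1)) _.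
  exact: sub0r.
have d5 : is_derive x 1 (fun t : R => t - x5) 1.
  apply: is_derive_eq (is_deriveB (is_derive_id x 1) (is_derive_cst x5 x 1)) _.
  exact: subr0.
have D0 := is_derive_chain (h := fun t : R => x0 - t)
  (is_derive_maxX 4 (x0 - x)) d0.
have D5 := is_derive_chain (h := fun t : R => t - x5)
  (is_derive_maxX 4 (x - x5)) d5.
apply: is_derive_eq (is_deriveD D0 D5) _.
by rewrite /daxial /=; ring.
Qed.

Lemma is_derive_sqr (X : normedModType R) (f : X -> R) p v df :
  is_derive p v f df -> is_derive p v (fun q => f q ^+ 2) (2%:R * f p * df).
Proof.
move=> fd; have := is_deriveM fd fd => H.
have -> : (fun q => f q ^+ 2) = f * f by apply/funext => q; rewrite expr2.
by apply: is_derive_eq H _; rewrite /GRing.scale/=; ring.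
Qed.

Lemma is_derive_capsule_fun (X : normedModType R) (gam : X -> 'rV[R]_3) p v
    (d : 'rV[R]_3) :
  (forall j, is_derive p v (fun q => gam q 0 j) (d 0 j)) ->
  is_derive p v (fun q => capsule_fun x0 x5 (gam q)) (dot (capsule_grad (gam p)) d).
Proof.
move=> dg.
have Dh := is_derive_chain (h := fun q => gam q 0 0)
  (is_derive_axial (gam p 0 0)) (dg 0).
have Dr := is_deriveD (is_derive_sqr (dg 1)) (is_derive_sqr (dg 2%:R)).
have d3 : forall t : R, is_derive t 1 (fun s : R => s ^+ 3) (3%:R * t ^+ 2).
  move=> t; split; first exact: exprn_derivable.
  by rewrite exp_derive [LHS]mulr1.
have D3 := is_derive_chain (h := fun q => gam q 0 1 ^+ 2 + gam q 0 2%:R ^+ 2)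
  (d3 _) Dr.
have D1 := is_deriveB (is_deriveD Dh D3) (is_derive_cst (1 : R) p v).
apply: is_derive_eq D1 _.
by rewrite dot3E /capsule_grad /= !vec3E /=; ring.
Qed.

Lemma dotE0 (v : 'rV[R]_3) : dot v v = 0 -> v = 0.
Proof.
rewrite dot3E -!expr2 => v0.
have := sqr_ge0 (v 0 0); have := sqr_ge0 (v 0 1); have := sqr_ge0 (v 0 2%:R).
move=> v2 v1 v0'.
by apply: row3P; rewrite mxE; apply/eqP; rewrite -sqrf_eq0; apply/eqP; lra.
Qed.

Lemma dot_ge0 (v : 'rV[R]_3) : 0 <= dot v v.
Proof. by rewrite dot3E -!expr2 !addr_ge0// sqr_ge0. Qed.

(** If the gradient vanishes, then [y = z = 0] and both positive parts vanish, so
that [capsule_fun] takes the value -1. *)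
Lemma capsule_grad_neq0 z : x0 < x5 -> capsule_fun x0 x5 z = 0 -> 0 < dot (capsule_grad z) (capsule_grad z).
Proof.
move=> x05 Fz; rewrite lt_neqAle dot_ge0 andbT eq_sym; apply/eqP => /dotE0 g0.
have := congr1 (fun v : 'rV[R]_3 => v 0 0) g0.
have := congr1 (fun v : 'rV[R]_3 => v 0 1) g0.
have := congr1 (fun v : 'rV[R]_3 => v 0 2%:R) g0.
move: Fz; rewrite /capsule_grad /capsule_fun /= !vec3E !mxE.
set r2 := z 0 1 ^+ 2 + z 0 2%:R ^+ 2 => Fz gz gy gx.
have r20 : r2 = 0.
  suff /eqP : r2 ^+ 3 = 0 by rewrite expf_eq0 => /eqP.
  have -> : r2 ^+ 3 = r2 ^+ 2 * (z 0 1 ^+ 2 + z 0 2%:R ^+ 2) by rewrite exprSr.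
  move: (r2 ^+ 2) gz gy => q gz gy.
  have : 6%:R * (q * (z 0 1 ^+ 2 + z 0 2%:R ^+ 2)) =
    z 0 1 * (6%:R * q * z 0 1) + z 0 2%:R * (6%:R * q * z 0 2%:R) by ring.
  by rewrite gy gz !mulr0 addr0 => /eqP; rewrite mulf_eq0 pnatr_eq0/= => /eqP.
move: Fz; rewrite r20 expr0n addr0 /axial => /eqP; rewrite subr_eq0 => /eqP.
move/eqP: gx; rewrite mulf_eq0 pnatr_eq0/= subr_eq0.
have [xx0|xx0] := ltP (z 0 0) x0.
  rewrite max0l; last by lra.
  by rewrite expr0n eq_sym expf_eq0/= => /eqP ->; rewrite !expr0n addr0 => /esym/eqP; rewrite oner_eq0.
rewrite [Num.max 0 (x0 - _)]max0l; last by lra.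
by rewrite expr0n expf_eq0/= => /eqP ->; rewrite !expr0n addr0 => /esym/eqP; rewrite oner_eq0.
Qed.

Lemma dotZl c (v w : 'rV[R]_3) : dot (c *: v) w = c * dot v w.
Proof. by rewrite !dot3E !mxE; ring. Qed.

Lemma dotZr c (v w : 'rV[R]_3) : dot v (c *: w) = c * dot v w.
Proof. by rewrite !dot3E !mxE; ring. Qed.

Lemma local_param_is_derive S U (gam : 'rV[R]_2 -> 'rV[R]_3) p i :
  local_param S U gam -> U p ->
  forall j, is_derive p (delta_mx 0 i) (fun q => gam q 0 j) (pd i gam p 0 j).
Proof.
move=> [oU /(CkP _ _ oU) [_ dg] _ _ _] Up j.
have [g' /(_ p Up)[gd _] _] := dg i.
split; first exact: (derivable_mxP gam p (delta_mx 0 i)).1 gd 0 j.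
by rewrite /pd derive_mx// mxE.
Qed.

(** The normalized gradient: [capsule_fun] is constant along every parametrization of the
capsule, hence its gradient is orthogonal to all tangent vectors. *)
Lemma capsule_unit_normal (x05 : x0 < x5) :
  exists N, unit_normal (capsule x0 x5) id N.
Proof.
pose N z := (Num.sqrt (dot (capsule_grad z) (capsule_grad z)))^-1 *: capsule_grad z.
exists N; split.
- have cc (j : 'I_3) : continuous (fun p : 'rV[R]_3 => p 0 j).
    exact: coord_continuous.
  have cr2 : continuous (fun z : 'rV[R]_3 => 6%:R * (z 0 1 ^+ 2 + z 0 2%:R ^+ 2) ^+ 2).
    apply: cont_mul; first exact: cst_continuous.
    by apply: cont_exp; apply: cont_add; apply: cont_exp.
  have cy : continuous (fun z : 'rV[R]_3 =>
      6%:R * (z 0 1 ^+ 2 + z 0 2%:R ^+ 2) ^+ 2 * z 0 1).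
    exact: cont_mul.
  have cz : continuous (fun z : 'rV[R]_3 =>
      6%:R * (z 0 1 ^+ 2 + z 0 2%:R ^+ 2) ^+ 2 * z 0 2%:R).
    exact: cont_mul.
  have cmax (f : 'rV[R]_3 -> R) : continuous f ->
      continuous (fun z => Num.max 0 (f z) ^+ 5).
    move=> cf z; apply: (@continuous_comp _ _ _ f (fun t => Num.max 0 t ^+ 5)).
      exact: cf.
    exact: (ck_cont (@ck1_maxX R 4)).
  have cx : continuous (fun z : 'rV[R]_3 => daxial (z 0 0)).
    apply: cont_mul; first exact: cst_continuous.
    by apply: cont_sub; apply: cmax; apply: cont_sub => //; exact: cst_continuous.
  have cd : continuous (fun z => dot (capsule_grad z) (capsule_grad z)).
    have -> : (fun z => dot (capsule_grad z) (capsule_grad z)) = (fun z : 'rV[R]_3 =>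
      daxial (z 0 0) * daxial (z 0 0)
      + (6%:R * (z 0 1 ^+ 2 + z 0 2%:R ^+ 2) ^+ 2 * z 0 1)
        * (6%:R * (z 0 1 ^+ 2 + z 0 2%:R ^+ 2) ^+ 2 * z 0 1)
      + (6%:R * (z 0 1 ^+ 2 + z 0 2%:R ^+ 2) ^+ 2 * z 0 2%:R)
        * (6%:R * (z 0 1 ^+ 2 + z 0 2%:R ^+ 2) ^+ 2 * z 0 2%:R)).
      by apply/funext => z; rewrite dot3E /capsule_grad /= !vec3E.
    apply: cont_add; last exact: cont_mul.
    by apply: cont_add; exact: cont_mul.
  have cg z : {for z, continuous capsule_grad}.
    exact: (@cvg_vec3 R _ _ _ _ z (cx z) (cy z) (cz z)).
  apply: continuous_in_subspaceT => z /set_mem.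
  rewrite capsuleE//= => Fz; have gpos := capsule_grad_neq0 x05 Fz.
  exact: cont_normalize cd (cg z) gpos.
- move=> z; rewrite capsuleE//= => Fz; have gpos := capsule_grad_neq0 x05 Fz.
  rewrite /N dotZl dotZr mulrA -expr2 exprVn sqr_sqrtr ?ltW//.
  by rewrite mulVf// gt_eqF.
- move=> U gam p i lp Up; rewrite /N dotZl.
  suff -> : dot (capsule_grad (gam p)) (pd i (id \o gam) p) = 0 by rewrite mulr0.
  have [_ <-] := is_derive_capsule_fun (local_param_is_derive i lp Up).
  have oU : open U by case: lp.
  rewrite (@near_eq_derive _ _ _ _ (fun=> 0)); first exact: derive_cst.
  apply: filterS (open_nbhs_nbhs (conj oU Up)) => q Uq.
  by have := local_param_sub lp Uq; rewrite capsuleE.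
Qed.

Lemma capsule_closed_hypersurface (x05 : x0 < x5) :
  closed_hypersurface (capsule x0 x5).
Proof.
split; [exact: capsule_compact|exact: capsule_connected| |exact: capsule_unit_normal].
by move=> z; exact: capsule_charts.
Qed.

End Normal.

Section Convexity.
Variables (R : realType) (x0 x5 : R).

(** By induction on [n]; the defect of one step is [t (1 - t) (a - b) (a^n - b^n)],
a product of factors of the same sign. *)
Lemma convex_pow n (t a b : R) : 0 <= t <= 1 -> 0 <= a -> 0 <= b ->
  (t * a + (1 - t) * b) ^+ n <= t * a ^+ n + (1 - t) * b ^+ n.
Proof.
move=> /andP[t0 t1] a0 b0; elim: n => [|n IH]; first by rewrite !expr0; lra.
rewrite exprS.
have m0 : 0 <= t * a + (1 - t) * b by rewrite addr_ge0// mulr_ge0// subr_ge0.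
apply: le_trans (ler_wpM2l m0 IH) _; rewrite !exprS -subr_ge0.
have -> : t * (a * a ^+ n) + (1 - t) * (b * b ^+ n)
   - (t * a + (1 - t) * b) * (t * a ^+ n + (1 - t) * b ^+ n)
   = t * (1 - t) * ((a - b) * (a ^+ n - b ^+ n)) by ring.
apply: mulr_ge0; first by rewrite mulr_ge0 ?subr_ge0.
have [ab|ba] := leP a b.
  by apply: mulr_le0; rewrite subr_le0// lerXn2r.
by apply: mulr_ge0; rewrite subr_ge0; [exact: ltW|rewrite lerXn2r// ltW].
Qed.

Lemma convex_max0 (t a b : R) : 0 <= t <= 1 ->
  Num.max 0 (t * a + (1 - t) * b) <= t * Num.max 0 a + (1 - t) * Num.max 0 b.
Proof.
move=> /andP[t0 t1].
have s0 : 0 <= 1 - t by rewrite subr_ge0.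
have [ma mb] : (0 <= Num.max 0 a /\ 0 <= Num.max 0 b) by rewrite !le_max lexx.
have [la lb] : (a <= Num.max 0 a /\ b <= Num.max 0 b) by rewrite !le_max !lexx !orbT.
by rewrite ge_max addr_ge0 ?mulr_ge0//= lerD// ler_wpM2l.
Qed.

Lemma convex_capsule_fun t (a b : 'rV[R]_3) : 0 <= t <= 1 ->
  capsule_fun x0 x5 (t *: a + (1 - t) *: b) <= t * capsule_fun x0 x5 a + (1 - t) * capsule_fun x0 x5 b.
Proof.
move=> t01; have /andP[t0 t1] := t01.
have s0 : 0 <= 1 - t by rewrite subr_ge0.
have maxX (u v : R) : Num.max 0 (t * u + (1 - t) * v) ^+ 6 <=
    t * Num.max 0 u ^+ 6 + (1 - t) * Num.max 0 v ^+ 6.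
  have ge0 (w : R) : 0 <= Num.max 0 w by rewrite le_max lexx.
  apply: le_trans (convex_pow 6 t01 (ge0 u) (ge0 v)).
  by rewrite lerXn2r ?nnegrE ?addr_ge0 ?mulr_ge0// convex_max0.
have sq (u v : R) : (t * u + (1 - t) * v) ^+ 2 <= t * u ^+ 2 + (1 - t) * v ^+ 2.
  rewrite -subr_ge0.
  have -> : t * u ^+ 2 + (1 - t) * v ^+ 2 - (t * u + (1 - t) * v) ^+ 2
    = t * (1 - t) * (u - v) ^+ 2 by ring.
  by rewrite mulr_ge0 ?sqr_ge0// mulr_ge0.
rewrite /capsule_fun /axial !mxE.
have h0 : Num.max 0 (x0 - (t * a 0 0 + (1 - t) * b 0 0)) ^+ 6 <=
    t * Num.max 0 (x0 - a 0 0) ^+ 6 + (1 - t) * Num.max 0 (x0 - b 0 0) ^+ 6.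
  by apply: le_trans (maxX _ _); rewrite le_eqVlt; apply/orP; left; apply/eqP;
    congr (Num.max 0 _ ^+ 6); ring.
have h5 : Num.max 0 (t * a 0 0 + (1 - t) * b 0 0 - x5) ^+ 6 <=
    t * Num.max 0 (a 0 0 - x5) ^+ 6 + (1 - t) * Num.max 0 (b 0 0 - x5) ^+ 6.
  by apply: le_trans (maxX _ _); rewrite le_eqVlt; apply/orP; left; apply/eqP;
    congr (Num.max 0 _ ^+ 6); ring.
set ra := a 0 1 ^+ 2 + a 0 2%:R ^+ 2; set rb := b 0 1 ^+ 2 + b 0 2%:R ^+ 2.
have ra0 : 0 <= ra by rewrite addr_ge0// sqr_ge0.
have rb0 : 0 <= rb by rewrite addr_ge0// sqr_ge0.
have h3 : ((t * a 0 1 + (1 - t) * b 0 1) ^+ 2 +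
    (t * a 0 2%:R + (1 - t) * b 0 2%:R) ^+ 2) ^+ 3 <= t * ra ^+ 3 + (1 - t) * rb ^+ 3.
  apply: le_trans (convex_pow 3 t01 ra0 rb0).
  rewrite lerXn2r ?nnegrE ?addr_ge0 ?sqr_ge0 ?mulr_ge0//.
  by have := sq (a 0 1) (b 0 1); have := sq (a 0 2%:R) (b 0 2%:R);
     rewrite /ra /rb; lra.
by lra.
Qed.

(** The solid capsule [capsule_fun <= 0] is a sublevel set of a convex function. A point
with [capsule_fun = 0] is not interior: pushed away from an inner point [m] with
[capsule_fun m < 0], it must leave the sublevel set, by convexity on the segment
through [m]. *)
Lemma capsule_bounds_convex (x05 : x0 < x5) : bounds_convex (capsule x0 x5).
Proof.
pose C : set 'rV[R]_3 := [set z | capsule_fun x0 x5 z <= 0].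
exists C; split.
  move=> a b l /set_mem Ca /set_mem Cb; apply/mem_set.
  have l01 : 0 <= l%:num <= 1 by rewrite ge0 le1.
  have := convex_capsule_fun a b l01 => H; apply: le_trans H _.
  have /andP[l0 l1] := l01.
  have s0 : 0 <= 1 - l%:num by rewrite subr_ge0.
  have := mulr_ge0_le0 l0 Ca; have := mulr_ge0_le0 s0 Cb; lra.
have clC : closure C = C.
  apply/esym/closure_id; apply: (@closed_comp _ _ (capsule_fun x0 x5) [set y | y <= 0]).
    by move=> z _; exact: continuous_capsule_fun.
  exact: closed_le.
rewrite clC capsuleE//; apply/seteqP; split=> z /=; last first.
  move=> [Cz nIz]; apply/eqP; rewrite eq_le; apply/andP; split; first exact: Cz.
  rewrite leNgt; apply/negP => Fz; apply: nIz.
  have oF : open [set y | capsule_fun x0 x5 y < 0].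
    by apply: open_ltf; [exact: continuous_capsule_fun|exact: cst_continuous].
  apply: filterS (open_nbhs_nbhs (conj oF Fz)) => y; exact: ltW.
move=> Fz; split; first by rewrite /C/= Fz.
move=> Iz.
(* Any point of the axis between the caps would do. *)
pose m : 'rV[R]_3 := vec3 x0 0 0.
have Fm : capsule_fun x0 x5 m = -1.
  by rewrite /capsule_fun !vec3E axial0 ?lexx ?ltW// expr0n addr0 expr0n addr0 sub0r.
have ce : (fun e : R => z + e *: (z - m)) @ 0 --> z.
  exact: cvg_ray.
have : \forall e \near 0^'+, C (z + e *: (z - m)).
  apply: cvg_within; exact: (ce _ Iz).
move=> /(filterI (nbhs_right_gt (0 : R)))/filter_ex[e [/= e0 Ce]].
have e1 : 0 < 1 + e by lra.
pose t := (1 + e)^-1.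
have t0 : 0 < t by rewrite invr_gt0.
have t1 : t < 1 by rewrite invf_lt1//; lra.
have t01 : 0 <= t <= 1 by rewrite !ltW.
have := convex_capsule_fun (z + e *: (z - m)) m t01.
have -> : t *: (z + e *: (z - m)) + (1 - t) *: m = z.
  have te : t * (1 + e) = 1 by rewrite mulVf// gt_eqF.
  move: (m) => n; apply/rowP => j; rewrite !mxE.
  have -> : t * (z 0 j + e * (z 0 j - n 0 j)) + (1 - t) * n 0 j =
    t * (1 + e) * z 0 j + (1 - t * (1 + e)) * n 0 j by ring.
  by rewrite te; ring.
rewrite Fz Fm; have := mulr_ge0_le0 (ltW t0) Ce; lra.
Qed.

End Convexity.

(** * Smooth extension, monotonicity of g, and points surrounded by a convex set *)

Section Concentration.
Variable R : realType.

Lemma is_derive_within (a b x l : R) (f : R -> R) : a < x < b ->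
  (f y - f x) / (y - x) @[y --> within `[a, b] x^'] --> l ->
  is_derive x 1 f l.
Proof.
move=> /andP[ax xb] fl.
have sh : (fun h : R => h + x) @ 0^' --> within `[a, b] x^'.
  move=> A nA.
  have n1 : nbhs x [set y | y != x -> y \in `[a, b] -> A y].
    have nA' : nbhs x [set y | y != x -> `[a, b]%classic y -> A y] := nA.
    by apply: filterS nA' => y yA yx yI; apply: yA.
  have n2 : nbhs x [set y | y \in `[a, b]].
    near=> y; rewrite /= in_itv/=; apply/andP; split; apply: ltW; near: y.
      exact: lt_nbhsr.
    exact: lt_nbhsl.
  have c : (fun h : R => h + x) @ (0 : R) --> x.
    have c0 : {for (0 : R), continuous (fun h : R => h + x)}.
      by apply: cvgD; [exact: cvg_id|exact: cvg_cst].
    by rewrite /prop_for /continuous_at add0r in c0.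
  have n12 : nbhs x ([set y | y != x -> y \in `[a, b] -> A y]
      `&` [set y | y \in `[a, b]]) by exact: filterI.
  have n3 := c _ n12.
  have n4 : nbhs (0 : R) [set h | h != 0 -> A (h + x)].
    have n3' : nbhs (0 : R) [set h | (h + x != x -> h + x \in `[a, b] -> A (h + x))
        /\ h + x \in `[a, b]] := n3.
    apply: filterS n3' => h [hA hI] h0; apply: hA => //.
    by rewrite -subr_eq0 addrK.
  exact: n4.
have L := cvg_comp _ _ sh fl.
have E : (fun h : R => h^-1 *: (f (h *: 1 + x) - f x) : R) @ 0^' --> l.
  apply: cvg_trans L; apply: near_eq_cvg; near=> h.
  by rewrite /= addrK [h *: 1]mulr1 mulrC.
split; first by apply/cvg_ex; exists l.
exact: cvg_lim E.
Unshelve. all: by end_near. Qed.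

(** A function that is smooth up to the end points of an interval and constant near
both of them extends by this constant to a smooth function on the line. All its
derivatives vanish near the end points because they do so in the
interior, where they are two-sided derivatives of a constant. *)
Lemma smooth_ext (a x1 x4 b c : R) (f : R -> R) :
  a < x1 -> x1 < x4 -> x4 < b -> smooth_on_itv a b f ->
  (forall x, x \in `[a, x1] -> f x = c) ->
  (forall x, x \in `[x4, b] -> f x = c) ->
  exists2 F : R -> R, (forall x, x \in `[a, b] -> F x = f x) &
    forall k, ck1 k setT F.
Proof.
move=> ax1 x14 x4b [d [d0 dS]] fl fr.
have dd k x : a < x < b -> is_derive x 1 (d k) (d k.+1 x).
  move=> xI; apply: (is_derive_within xI); apply: dS.
  by have /andP[? ?] := xI; rewrite in_itv/= !ltW.
(* The value taken near the end points by the k-th derivative. *)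
pose K k : R := if k is 0%N then c else 0.
have dK (u v : R) : a <= u -> v <= b -> (forall x, u < x < v -> f x = c) ->
    forall k x, u < x < v -> d k x = K k.
  move=> au vb fc; elim=> [|k IH] x /andP[ux xv].
    by rewrite d0 ?fc ?ux// in_itv/=; apply/andP; split; lra.
  have xab : a < x < b by apply/andP; split; lra.
  have [_ <-] := dd k x xab.
  rewrite (@near_eq_derive _ _ _ _ (fun=> K k)); first exact: derive_cst.
  near=> y; apply: IH; apply/andP; split; near: y.
    exact: lt_nbhsr.
  exact: lt_nbhsl.
have dl := dK a x1 (lexx _) (ltW (lt_trans x14 x4b)).
have dr := dK x4 b (ltW (lt_trans ax1 x14)) (lexx _).
have {}dl : forall k x, a < x < x1 -> d k x = K k.
  by apply: dl => x /andP[? ?]; apply: fl; rewrite in_itv/= !ltW.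
have {}dr : forall k x, x4 < x < b -> d k x = K k.
  by apply: dr => x /andP[? ?]; apply: fr; rewrite in_itv/= !ltW.
pose D k x := if (a < x < b) then d k x else K k.
have Dl k x : x < x1 -> D k x = K k.
  by move=> xx1; rewrite /D; case: ifPn => // /andP[ax _]; rewrite dl ?ax.
have Dr k x : x4 < x -> D k x = K k.
  by move=> xx4; rewrite /D; case: ifPn => // /andP[_ xb]; rewrite dr ?xx4.
have cK k (x l : R) : is_derive x l (fun=> K k) (K k.+1).
  exact: is_derive_cst.
have DD k (x : R) : is_derive x 1 (D k) (D k.+1 x).
  have [xx1|x1x] := ltP x x1.
    rewrite Dl//; apply: near_eq_is_derive (cK k x 1).
    by near=> y; rewrite Dl//; near: y; exact: lt_nbhsl.
  have [xx4|x4x] := ltP x4 x.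
    rewrite Dr//; apply: near_eq_is_derive (cK k x 1).
    by near=> y; rewrite Dr//; near: y; exact: lt_nbhsr.
  have xab : a < x < b by apply/andP; split; lra.
  rewrite {2}/D xab; apply: near_eq_is_derive (dd k x xab).
  have /andP[ax xb] := xab.
  near=> y; rewrite /D ifT//; apply/andP; split; near: y.
    exact: lt_nbhsr.
  exact: lt_nbhsl.
exists (D 0%N).
  move=> x; rewrite in_itv/= => /andP[ax xb].
  rewrite /D; case: ifPn => [xab|].
    by rewrite d0// in_itv/= ax.
  rewrite negb_and -!leNgt => /orP[xa|bx].
    by rewrite fl// in_itv/= ax/=; lra.
  by rewrite fr// in_itv/= xb andbT; lra.
move=> k; elim: k 0%N => [|k IH] j.
  split=> // x _; apply/differentiable_continuous/derivable1_diffP.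
  by have [] := DD j x.
split=> [x _|i].
  apply/differentiable_continuous/derivable1_diffP; by have [] := DD j x.
by exists (D j.+1).
Unshelve. all: by end_near. Qed.

(** The derivative of [c |-> G c - G' c * c] is [- G'' c * c]. *)
Lemma gfun_decr (G : R -> R) (a b : R) : class_C 7 G ->
  (forall c, 0 < derive1n 2 G c) -> 0 < a -> a < b -> gfun G b < gfun G a.
Proof.
move=> [dG _] G2 a0 ab.
have D0 (x : R) : is_derive x 1 G (derive1 G x).
  by rewrite derive1E; apply: derivableP; exact: (dG 0%N).
have D1 (x : R) : is_derive x 1 (derive1 G) (derive1n 2 G x).
  have := dG 1%N x isT; rewrite derive1n1 => dx.
  rewrite (derive1nS G 1) derive1n1 derive1E; exact: derivableP.
have Dg (x : R) : is_derive x 1 (gfun G) (- (derive1n 2 G x * x)).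
  apply: is_derive_eq (is_deriveB (D0 x) (is_deriveM (D1 x) (is_derive_id x 1))) _.
  by rewrite /GRing.scale/=; ring.
have cg : {within `[a, b], continuous (gfun G)}.
  apply: derivable_within_continuous => x _; by have [] := Dg x.
have [c cI E] := MVT ab (fun x _ => Dg x) cg.
move: cI; rewrite in_itv/= => /andP[ac cb].
rewrite -subr_lt0 E pmulr_llt0 ?subr_gt0// oppr_lt0 mulr_gt0//.
exact: lt_trans ac.
Qed.

End Concentration.

Section Surrounded.
Variable R : realType.
Implicit Types (C : set 'rV[R]_3) (q p : 'rV[R]_3).

Definition beyond (b : bool) (j : 'I_3) q p : Prop :=
  if b then q 0 j < p 0 j else p 0 j < q 0 j.

Lemma convex_set_comb (C : set (convex_lmodType 'rV[R]_3)) (a b : 'rV[R]_3) t :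
  convex_set C -> 0 <= t -> t <= 1 -> C a -> C b -> C (t *: a + (1 - t) *: b).
Proof.
move=> cC t0 t1 Ca Cb.
have := cC a b (Itv01 t0 t1) (mem_set Ca) (mem_set Cb).
by move=> /set_mem.
Qed.

Lemma comb_beyond b j q p p' t : 0 <= t <= 1 -> beyond b j q p -> beyond b j q p' ->
  beyond b j q (t *: p + (1 - t) *: p').
Proof.
move=> /andP[t0 t1].
have pos (u v : R) : 0 < u -> 0 < v -> 0 < t * u + (1 - t) * v.
  move=> u0 v0; have [->|tn] := eqVneq t 0; first by lra.
  have tgt : 0 < t by rewrite lt_neqAle eq_sym tn.
  by rewrite ltr_pwDl ?mulr_gt0// mulr_ge0 ?subr_ge0// ltW.
case: b; rewrite /beyond !mxE => qp qp'; rewrite -subr_gt0.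
  have -> : t * p 0 j + (1 - t) * p' 0 j - q 0 j =
    t * (p 0 j - q 0 j) + (1 - t) * (p' 0 j - q 0 j) by ring.
  by apply: pos; rewrite subr_gt0.
have -> : q 0 j - (t * p 0 j + (1 - t) * p' 0 j) =
  t * (q 0 j - p 0 j) + (1 - t) * (q 0 j - p' 0 j) by ring.
by apply: pos; rewrite subr_gt0.
Qed.

Lemma comb_coord j q p p' t : p 0 j = q 0 j -> p' 0 j = q 0 j ->
  (t *: p + (1 - t) *: p') 0 j = q 0 j.
Proof. by move=> pj p'j; rewrite !mxE pj p'j; ring. Qed.

Lemma comb_between j q p p' : beyond true j q p -> beyond false j q p' ->
  exists t, 0 <= t <= 1 /\ (t *: p + (1 - t) *: p') 0 j = q 0 j.
Proof.
rewrite /beyond => qp p'q.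
have pp : 0 < p 0 j - p' 0 j by lra.
exists ((q 0 j - p' 0 j) / (p 0 j - p' 0 j)); split.
  by rewrite divr_ge0 ?ler_pdivrMr//=; lra.
by rewrite !mxE; field; rewrite gt_eqF.
Qed.

(** Eight points, one in each open octant around [q]: on the segment between two
points whose octants differ in one coordinate only, some point agrees with [q]
in this coordinate and stays strictly on the same side in the others. Three such
steps lead to [q]. *)
Lemma surrounded_mem (C : set (convex_lmodType 'rV[R]_3)) q : convex_set C ->
  (forall b0 b1 b2, exists2 p, (C : set 'rV[R]_3) p &
    [/\ beyond b0 0 q p, beyond b1 1 q p & beyond b2 2%:R q p]) ->
  (C : set 'rV[R]_3) q.
Proof.
move=> cC H.
have H2 b0 b1 : exists2 p, (C : set 'rV[R]_3) p &
    [/\ beyond b0 0 q p, beyond b1 1 q p & p 0 2%:R = q 0 2%:R].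
  have [p Cp [p0 p1 p2]] := H b0 b1 true.
  have [p' Cp' [p'0 p'1 p'2]] := H b0 b1 false.
  have [t [t01 tE]] := comb_between p2 p'2.
  exists (t *: p + (1 - t) *: p').
    by have /andP[t0 t1] := t01; exact: convex_set_comb.
  by split=> //; exact: comb_beyond.
have H1 b0 : exists2 p, (C : set 'rV[R]_3) p &
    [/\ beyond b0 0 q p, p 0 1 = q 0 1 & p 0 2%:R = q 0 2%:R].
  have [p Cp [p0 p1 p2]] := H2 b0 true.
  have [p' Cp' [p'0 p'1 p'2]] := H2 b0 false.
  have [t [t01 tE]] := comb_between p1 p'1.
  exists (t *: p + (1 - t) *: p').
    by have /andP[t0 t1] := t01; exact: convex_set_comb.
  by split=> //; [exact: comb_beyond|exact: comb_coord].
have [p Cp [p0 p1 p2]] := H1 true.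
have [p' Cp' [p'0 p'1 p'2]] := H1 false.
have [t [t01 tE]] := comb_between p0 p'0.
have /andP[t0 t1] := t01.
suff <- : t *: p + (1 - t) *: p' = q by exact: convex_set_comb.
by apply: row3P => //; exact: comb_coord.
Qed.

Lemma near_beyond b j q p : beyond b j q p ->
  (\forall q' \near q, beyond b j q' p) /\ (\forall p' \near p, beyond b j q p').
Proof.
have cc : continuous (fun p : 'rV[R]_3 => p 0 j).
  exact: coord_continuous.
have o1 a : open [set z : 'rV[R]_3 | z 0 j < a].
  by apply: open_ltf => //; exact: cst_continuous.
have o2 a : open [set z : 'rV[R]_3 | a < z 0 j].
  by apply: open_ltf => //; exact: cst_continuous.
case: b; rewrite /beyond => qp; split.
- exact: (open_nbhs_nbhs (conj (o1 _) qp)).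
- exact: (open_nbhs_nbhs (conj (o2 _) qp)).
- exact: (open_nbhs_nbhs (conj (o2 _) qp)).
- exact: (open_nbhs_nbhs (conj (o1 _) qp)).
Qed.

(** The octant conditions are open both in [q] and in the eight points. So the
points can be moved from the closure into the set itself, and they keep
surrounding every point close to [q]. *)
Lemma surrounded_interior (C : set (convex_lmodType 'rV[R]_3)) q : convex_set C ->
  (forall b0 b1 b2, exists2 p, closure (C : set 'rV[R]_3) p &
    [/\ beyond b0 0 q p, beyond b1 1 q p & beyond b2 2%:R q p]) ->
  interior (C : set 'rV[R]_3) q.
Proof.
move=> cC H.
have N : forall b : bool * bool * bool, \forall q' \near q,
    exists2 p, (C : set 'rV[R]_3) p &
    [/\ beyond b.1.1 0 q' p, beyond b.1.2 1 q' p & beyond b.2 2%:R q' p].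
  move=> [[b0 b1] b2] /=.
  have [p clp [p0 p1 p2]] := H b0 b1 b2.
  have [_ n0] := near_beyond p0; have [_ n1] := near_beyond p1.
  have [_ n2] := near_beyond p2.
  have [r [Cr [r0 [r1 r2]]]] := clp _ (filterI n0 (filterI n1 n2)).
  have [m0 _] := near_beyond r0; have [m1 _] := near_beyond r1.
  have [m2 _] := near_beyond r2.
  near=> q'; exists r => //; split; near: q'.
  - exact: m0.
  - exact: m1.
  - exact: m2.
have : \forall q' \near q, forall b : bool * bool * bool,
    exists2 p, (C : set 'rV[R]_3) p &
    [/\ beyond b.1.1 0 q' p, beyond b.1.2 1 q' p & beyond b.2 2%:R q' p].
  exact: (@filter_forall _ _ _ (nbhs q) _ N).
apply: filterS => q' Nq'.
apply: surrounded_mem cC _ => b0 b1 b2.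
exact: (Nq' (b0, b1, b2)).
Unshelve. all: by end_near. Qed.

End Surrounded.

(** * The cylindrical part at time zero *)

Section Cylinder.
Variables (R : realType) (x0 x5 : R).
Implicit Types (p : 'rV[R]_2).

Definition radial (p : 'rV[R]_2) : 'rV[R]_3 := vec3 0 (cos (p 0 1)) (sin (p 0 1)).

Definition cyl_dom (phi0 : R) : set 'rV[R]_2 :=
  tube_dom x0 x5 phi0 `&` [set p | x0 < p 0 0 < x5].

Lemma open_cyl_dom phi0 : open (cyl_dom phi0).
Proof.
have cc (j : 'I_2) : continuous (fun p : 'rV[R]_2 => p 0 j).
  exact: coord_continuous.
have o1 : open [set p : 'rV[R]_2 | x0 < p 0 0].
  by apply: open_ltf => //; exact: cst_continuous.
have o2 : open [set p : 'rV[R]_2 | p 0 0 < x5].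
  by apply: open_ltf => //; exact: cst_continuous.
have := openI (@open_tube_dom R x0 x5 phi0) (openI o1 o2).
suff -> : cyl_dom phi0 = tube_dom x0 x5 phi0 `&`
  ([set p : 'rV[R]_2 | x0 < p 0 0] `&` [set p : 'rV[R]_2 | p 0 0 < x5]) by [].
by congr (_ `&` _); apply/seteqP; split=> p /=; move=> /andP.
Qed.

Lemma w0_cyl (x05 : x0 < x5) x : x0 <= x <= x5 -> w0 x0 x5 x = 1.
Proof. by move=> xI; rewrite w0E ?axial0 ?subr0 ?powR1. Qed.

Lemma pd_cyl phi0 p : cyl_dom phi0 p ->
  pd 0 (tube x0 x5) p = vec3 1 0 0 /\
  pd 1 (tube x0 x5) p = vec3 0 (- sin (p 0 1)) (cos (p 0 1)).
Proof.
move=> [_ /= /andP[p0 p5]]; have x05 := lt_trans p0 p5.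
have dw : is_derive (p 0 0) 1 (w0 x0 x5) 0.
  apply: (near_eq_is_derive (f := fun _ : R => (1 : R))).
  near=> x; rewrite w0_cyl//; apply/andP; split; apply: ltW; near: x.
    exact: lt_nbhsr.
  exact: lt_nbhsl.
have [-> ->] := pd_tube dw.
by rewrite !mul0r w0_cyl ?mul1r// !ltW.
Unshelve. all: by end_near. Qed.

(** The tangent plane of the cylinder is spanned by the axis and the direction of
the parallel. The surface parametrized by [theta] only has to agree with the
capsule, as [graph_param] does at time 0. *)
Lemma unit_normal_radial (x05 : x0 < x5) theta N phi0 p :
  unit_normal (capsule x0 x5) theta N ->
  (forall z, capsule x0 x5 z -> theta z = z) -> cyl_dom phi0 p ->
  exists2 s, s ^+ 2 = 1 & N (tube x0 x5 p) = s *: radial p.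
Proof.
move=> [_ N1 Nperp] thetaE pU; have [pT _] := pU.
have lp := local_param_tube x05 phi0.
have oU := @open_tube_dom R x0 x5 phi0.
have pdE i : pd i (theta \o tube x0 x5) p = pd i (tube x0 x5) p.
  apply: near_eq_derive.
  apply: filterS (open_nbhs_nbhs (conj oU pT)) => q qU.
  by rewrite /= thetaE//; exact: (local_param_sub lp).
have [d0 d1] := pd_cyl pU.
have n0 := Nperp _ _ _ 0 lp pT; have n1 := Nperp _ _ _ 1 lp pT.
have n2 := N1 _ (local_param_sub lp pT).
move: n0 n1 n2; rewrite !pdE d0 d1 !dot3E !vec3E; set n := N _.
rewrite !mulr0 !addr0 mulr1 add0r.
have := cos2Dsin2 (p 0 1); set c := cos _; set s := sin _ => cs n0 n1 n2.
have nc : n 0 1 = (n 0 1 * c + n 0 2%:R * s) * c.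
  have -> : (n 0 1 * c + n 0 2%:R * s) * c =
    n 0 1 * (c ^+ 2 + s ^+ 2) + s * (n 0 1 * - s + n 0 2%:R * c) by ring.
  by rewrite cs n1; ring.
have ns : n 0 2%:R = (n 0 1 * c + n 0 2%:R * s) * s.
  have -> : (n 0 1 * c + n 0 2%:R * s) * s =
    n 0 2%:R * (c ^+ 2 + s ^+ 2) - c * (n 0 1 * - s + n 0 2%:R * c) by ring.
  by rewrite cs n1; ring.
exists (n 0 1 * c + n 0 2%:R * s); last first.
  apply: row3P; rewrite [RHS]mxE vec3E ?mulr0 -/c -/s//.
move: n2; rewrite n0 mul0r add0r; move: nc ns.
set k := n 0 1 * c + n 0 2%:R * s => -> -> <-.
by rewrite -[LHS]mulr1 -cs; ring.
Qed.

Lemma radial_dot p : dot (radial p) (radial p) = 1.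
Proof. by rewrite dot3E /radial !vec3E mul0r add0r -!expr2 cos2Dsin2. Qed.

Lemma continuous_radial : continuous radial.
Proof.
move=> p; apply: (@cvg_vec3 R _ (cst 0) (fun p : 'rV[R]_2 => cos (p 0 1))
  (fun p : 'rV[R]_2 => sin (p 0 1)) p).
- exact: cst_continuous.
- apply: (@continuous_comp _ _ _ (fun p : 'rV[R]_2 => p 0 1) (@cos R)).
    exact: coord_continuous.
  exact: continuous_cos.
- apply: (@continuous_comp _ _ _ (fun p : 'rV[R]_2 => p 0 1) (@sin R)).
    exact: coord_continuous.
  exact: continuous_sin.
Qed.

Lemma cont_dot (T : topologicalType) (f g : T -> 'rV[R]_3) z :
  {for z, continuous f} -> {for z, continuous g} ->
  {for z, continuous (fun x => dot (f x) (g x))}.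
Proof.
move=> cf cg.
have cc (h : T -> 'rV[R]_3) j : {for z, continuous h} ->
    {for z, continuous (fun x => h x 0 j)}.
  move=> ch; apply: (@continuous_comp _ _ _ h (fun v : 'rV[R]_3 => v 0 j)).
    exact: ch.
  exact: coord_continuous.
rewrite (_ : (fun x => dot (f x) (g x)) = (fun x => f x 0 0 * g x 0 0 +
  f x 0 1 * g x 0 1 + f x 0 2%:R * g x 0 2%:R)); last first.
  by apply/funext => x; rewrite dot3E.
by apply: cvgD; [apply: cvgD|]; apply: cvgM; exact: cc.
Qed.

(** The sign [s] is a continuous function of the point with values 1 and -1, hence
locally constant. *)
Lemma unit_normal_locally_radial (x05 : x0 < x5) theta N phi0 p s :
  unit_normal (capsule x0 x5) theta N ->
  (forall z, capsule x0 x5 z -> theta z = z) -> cyl_dom phi0 p ->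
  N (tube x0 x5 p) = s *: radial p ->
  \forall q \near p, N (tube x0 x5 q) = s *: radial q.
Proof.
move=> uN thetaE pU Np.
have lp := local_param_tube x05 phi0.
have oU := @open_tube_dom R x0 x5 phi0.
have sE : dot (N (tube x0 x5 p)) (radial p) = s by rewrite Np dotZl radial_dot mulr1.
have cN : {for p, continuous (fun q => N (tube x0 x5 q))}.
  have [/subspace_continuousP cN _ _] := uN.
  have Sp : capsule x0 x5 (tube x0 x5 p) by exact: (local_param_sub lp pU.1).
  have ct : {for p, continuous (tube x0 x5)}.
    by have := ck_cont (ck2_tube x05 phi0) pU.1.
  have ct' : tube x0 x5 q @[q --> p] --> within (capsule x0 x5) (nbhs (tube x0 x5 p)).
    move=> A nA; have {}nA := ct _ nA.
    have nU := open_nbhs_nbhs (conj oU pU.1).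
    have nB : nbhs p [set q | A (tube x0 x5 q)].
      apply: filterS (filterI nU nA) => q [qU]; apply.
      exact: (local_param_sub lp).
    exact: nB.
  exact: (cvg_comp _ _ ct' (cN _ Sp)).
have cs := cont_dot cN (continuous_radial (x := p)).
have {}cs : dot (N (tube x0 x5 q)) (radial q) @[q --> p] --> s.
  by rewrite -sE; exact: cs.
have near1 : \forall q \near p, `|s - dot (N (tube x0 x5 q)) (radial q)| < 1.
  by move/cvgrPdist_lt : cs => /(_ 1 ltr01).
have nU : nbhs p (cyl_dom phi0).
  by apply: open_nbhs_nbhs; split=> //; exact: open_cyl_dom.
have nn : nbhs p ([set q | `|s - dot (N (tube x0 x5 q)) (radial q)| < 1]
    `&` cyl_dom phi0) by exact: filterI.
apply: filterS nn => q [qs qU].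
have [s' s'2 Nq] := unit_normal_radial x05 uN thetaE qU.
have [s2 s22 Np'] := unit_normal_radial x05 uN thetaE pU.
have ss2 : s2 = s by rewrite -sE Np' dotZl radial_dot mulr1.
rewrite ss2 in s22.
move: qs; rewrite /= Nq dotZl radial_dot mulr1 => qs.
congr (_ *: _); apply/eqP; rewrite -subr_eq0.
have /eqP : (s' - s) * (s' + s) = 0 by rewrite -subr_sqr s'2 s22 subrr.
rewrite mulf_eq0 => /orP[//|]; rewrite (addr_eq0 s' s) => /eqP s'E.
move: qs; rewrite s'E opprK -mulr2n normrMn => qs.
have : (`|s| *+ 2) ^+ 2 < 1 by rewrite expr_lt1// mulrn_wge0.
by rewrite exprMn_n real_normK ?num_real// s22 => ?; exfalso; lra.
Qed.

(** In the coordinates (axis, angle) the unit cylinder has the identity metric; the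
radial field is constant along the axis and its angular derivative is the unit
tangent, so that its divergence is 1. *)
Lemma mean_curv_cyl (x05 : x0 < x5) theta N phi0 p s :
  unit_normal (capsule x0 x5) theta N ->
  (forall z, capsule x0 x5 z -> theta z = z) -> cyl_dom phi0 p ->
  N (tube x0 x5 p) = s *: radial p ->
  mean_curv (theta \o tube x0 x5) (N \o tube x0 x5) p = - s.
Proof.
move=> uN thetaE pU Np.
have lp := local_param_tube x05 phi0.
have oU := @open_tube_dom R x0 x5 phi0.
have [d0 d1] := pd_cyl pU.
have pdE i : pd i (theta \o tube x0 x5) p = pd i (tube x0 x5) p.
  apply: near_eq_derive.
  apply: filterS (open_nbhs_nbhs (conj oU pU.1)) => q qU.
  by rewrite /= thetaE//; exact: (local_param_sub lp).
have cs := cos2Dsin2 (p 0 1).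
have metricE : metric (theta \o tube x0 x5) p = 1%:M.
  apply/matrixP => i j; rewrite /metric !mxE.
  move: i j; apply: ord2_ind; apply: ord2_ind;
    rewrite !pdE ?d0 ?d1 dot3E !vec3E /= ?mulr1n ?mulr0n; try ring.
  by rewrite -cs; ring.
have NE i : pd i (N \o tube x0 x5) p = pd i (fun q => s *: radial q) p.
  by apply: near_eq_derive; exact: (unit_normal_locally_radial x05 uN thetaE pU Np).
have dC i : is_derive p (delta_mx 0 i) (fun q : 'rV[R]_2 => s * cos (q 0 1))
    (s * - sin (p 0 1) * (i == 1)%:R).
  have ds : is_derive (p 0 1) 1 (fun t : R => s * cos t) (s * - sin (p 0 1)).
    exact: (is_deriveZ s (is_derive_cos (p 0 1))).
  exact: (is_derive_chain (h := fun q : 'rV[R]_2 => q 0 1) ds (pd_coord i 1 p)).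
have dS i : is_derive p (delta_mx 0 i) (fun q : 'rV[R]_2 => s * sin (q 0 1))
    (s * cos (p 0 1) * (i == 1)%:R).
  have ds : is_derive (p 0 1) 1 (fun t : R => s * sin t) (s * cos (p 0 1)).
    exact: (is_deriveZ s (is_derive_sin (p 0 1))).
  exact: (is_derive_chain (h := fun q : 'rV[R]_2 => q 0 1) ds (pd_coord i 1 p)).
have dN i : pd i (fun q => s *: radial q) p =
    vec3 0 (s * - sin (p 0 1) * (i == 1)%:R) (s * cos (p 0 1) * (i == 1)%:R).
  apply: pd_row3.
  - rewrite (_ : (fun q => _) = fun=> 0); first exact: is_derive_cst.
    by apply/funext => q; rewrite mxE vec3E mulr0.
  - rewrite (_ : (fun q => _) = fun q : 'rV[R]_2 => s * cos (q 0 1)); first exact: dC.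
    by apply/funext => q; rewrite mxE vec3E.
  - rewrite (_ : (fun q => _) = fun q : 'rV[R]_2 => s * sin (q 0 1)); first exact: dS.
    by apply/funext => q; rewrite mxE vec3E.
have D i j : dot (pd i (N \o tube x0 x5) p) (pd j (theta \o tube x0 x5) p) =
    s * ((i == 1) && (j == 1))%:R.
  rewrite NE dN pdE; move: i j; apply: ord2_ind; apply: ord2_ind;
    rewrite ?d0 ?d1 dot3E !vec3E /=; try ring.
  by transitivity (s * (cos (p 0 1) ^+ 2 + sin (p 0 1) ^+ 2)); [ring|rewrite cs].
rewrite /mean_curv /surf_div metricE invmx1; congr (- _).
under eq_bigr => i _ do under eq_bigr => j _ do rewrite D mxE.
by rewrite !sum_ord2 /=; ring.
Qed.

End Cylinder.

Section Evolution.
Variables (R : realType) (x0 x5 : R).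

(** At time 0 the normal of the evolving surface is [nu], the geometric factor of
the equation is 1, and the mean curvature is minus the sign of [nu] relative to
the radial direction. In the radial coordinate this sign cancels: on the
cylinder every point moves along its own ray, with initial speed [- g]. *)
Lemma initial_velocity (x05 : x0 < x5) (G : R -> R) nu u0 T rho u :
  unit_normal (capsule x0 x5) id nu ->
  evolution G (capsule x0 x5) nu u0 T rho u ->
  forall e, 0 < e -> \forall t \near within `[0, T] 0^', forall x phi,
    x0 < x < x5 -> exists2 r,
      `|(r - 1) / t + gfun G (u0 (revol x0 x5 x phi))| <= e &
      graph_param nu rho t (revol x0 x5 x phi) = vec3 x (r * cos phi) (r * sin phi).
Proof.
move=> unu [drho [du [N [T0 [[_ _ rho1] _] _ [adm init] eqn]]]] e e0.
have z0 : 0 \in `[0, T] by rewrite in_itv/= lexx ltW.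
have := rho1 0 z0 e e0; apply: filterS => t Ht x phi xI.
pose p := row2 x phi.
have pU : cyl_dom x0 x5 phi p.
  have pi2 : 0 < pi / 2 :> R by rewrite divr_gt0// pi_gt0.
  by have /andP[? ?] := xI; split; [split|]; rewrite /= !row2E; apply/andP; split; lra.
have zE : tube x0 x5 p = revol x0 x5 x phi by rewrite /tube !row2E.
have lp := local_param_tube x05 phi.
have Sz : capsule x0 x5 (tube x0 x5 p) by exact: (local_param_sub lp pU.1).
have idE z : capsule x0 x5 z -> id z = z by [].
have thE z : capsule x0 x5 z -> graph_param nu rho 0 z = z.
  by move=> /init[r0 _]; rewrite /graph_param r0 scale0r addr0.
have [_ _ uN pos] := adm 0 z0.
have [s' s'2 nuE] := unit_normal_radial x05 unu idE pU.
have [s s2 NE] := unit_normal_radial x05 uN thE pU.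
(* Both normals point to the same side. *)
have ss' : s = s'.
  have := pos _ Sz; rewrite nuE NE dotZl dotZr radial_dot mulr1 => sp.
  have /eqP : (s - s') * (s + s') = 0 by rewrite -subr_sqr s2 s'2 subrr.
  rewrite mulf_eq0 subr_eq0 => /orP[/eqP//|]; rewrite addr_eq0 => /eqP sE.
  by move: sp; rewrite sE mulrN -expr2 s'2 => ?; exfalso; lra.
have [drE _] := eqn 0 _ _ p z0 lp pU.1.
move: drE; rewrite (mean_curv_cyl x05 uN thE pU NE) /=.
rewrite nuE NE dotZl dotZr radial_dot mulr1 ss' -expr2 s'2 invr1 mulr1.
have [r0 ->] := init _ Sz.
move=> drE; exists (1 + rho t (tube x0 x5 p) * s').
  move: (Ht _ Sz); rewrite drE r0 !subr0 zE.
  set g := gfun _ _; set r := rho _ _ => Hr.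
  have -> : (1 + r * s' - 1) / t + g = s' * (r / t - g * - s').
    transitivity (s' * (r / t) + g * s' ^+ 2); first by rewrite s'2; ring.
    by ring.
  have ns : `|s'| = 1.
    by have /eqP := s'2; rewrite sqrf_eq1 => /orP[]/eqP ->; rewrite ?normrN1 ?normr1.
  by rewrite normrM ns mul1r.
rewrite /graph_param -zE nuE scalerA; have xw : w0 x0 x5 x = 1.
  by rewrite w0_cyl//; have /andP[? ?] := xI; rewrite !ltW.
by apply: row3P; rewrite !mxE /= ?mxE /= ?xw; ring.
Qed.

(** In a chart the concentration is a function of the first coordinate alone, to
which the chain rule applies after extension to the whole line. *)
Lemma Ck_on_u0 (x05 : x0 < x5) (x1 x4 c : R) (c0 : R -> R) (u0 : 'rV[R]_3 -> R) :
  x0 - 1 < x1 -> x1 < x4 -> x4 < x5 + 1 -> smooth_on_itv (x0 - 1) (x5 + 1) c0 ->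
  (forall x, x \in `[x0 - 1, x1] -> c0 x = c) ->
  (forall x, x \in `[x4, x5 + 1] -> c0 x = c) ->
  (forall z, capsule x0 x5 z -> u0 z = c0 (z 0 0)) ->
  Ck_on (capsule x0 x5) 4 u0.
Proof.
move=> h1 h14 h4 sm cl cr u0E U gam lp.
have [F FE ckF] := smooth_ext h1 h14 h4 sm cl cr.
have [oU kg _ _ _] := lp.
apply/CkP => //; apply: (ck_eq (f := fun p => F (gam p 0 0))) => //.
  move=> p Up; have Sp := local_param_sub lp Up; rewrite /= u0E// FE//.
  by have [x xI [phi _ <-]] := Sp; rewrite -[revol _ _ _ _]/(vec3 _ _ _) vec3E.
apply: (@ck_comp R 'rV[R]_2 'I_2 (delta_mx 0) 4 setT U F (fun p => gam p 0 0)) => //.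
by apply: (@ckW _ _ _ _ _ 4 5) => //; move: kg => /(CkP _ _ oU)/ck_row; exact.
Qed.

End Evolution.

(** * Surfaces with a waist *)

Section Waist.
Variable R : realType.

(** If the surface bounds a convex set, then the two outer parallels force the point
on the middle one into the interior: points at angles [phi] and [- phi] on both
outer parallels lie further out, points at right angles lie further in, above
and below, and these eight points occupy all octants. *)
Lemma waist_not_convex (S : set 'rV[R]_3) (xa xm xb r2 r1 : R)
    (ra rb : R -> R) rm :
  xa < xm -> xm < xb -> r2 < r1 -> 0 < rm -> rm <= r2 ->
  (forall phi, r1 <= ra phi /\ S (vec3 xa (ra phi * cos phi) (ra phi * sin phi))) ->
  (forall phi, r1 <= rb phi /\ S (vec3 xb (rb phi * cos phi) (rb phi * sin phi))) ->
  S (vec3 xm rm 0) -> ~ bounds_convex S.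
Proof.
move=> xam xmb r21 rm0 rm2 Ha Hb Hm [C [cC SE]].
have r10 : 0 < r1 by lra.
have pi0 : 0 < pi :> R := pi_gt0 R.
(* The angle must be so small that the outer points still project beyond radius r2. *)
have [phi [sphi cphi]] : exists phi : R, 0 < sin phi /\ r2 < r1 * cos phi.
  have : \forall phi \near 0^'+, r2 / r1 < cos (phi : R).
    have cc : cos phi @[phi --> (0 : R)^'+] --> (1 : R).
      by rewrite -cos0; apply: cvg_at_right_filter; exact: continuous_cos.
    by apply: (cvgr_gt _ cc); rewrite ltr_pdivrMr// mul1r.
  move=> near1; near (0 : R)^'+ => phi.
  exists phi; split; last by rewrite mulrC -ltr_pdivrMr//; near: phi; exact: near1.
  apply: sin_gt0_pi; apply/andP; split; near: phi; first exact: nbhs_right_gt.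
  exact: nbhs_right_lt.
have clS p : S p -> closure (C : set 'rV[R]_3) p by rewrite SE => -[].
pose psi b1 b2 : R :=
  if b1 then (if b2 then phi else - phi) else (if b2 then pi / 2 else - (pi / 2)).
have side x (rr : R -> R) b1 b2 : (forall phi, r1 <= rr phi) ->
    let p := vec3 x (rr (psi b1 b2) * cos (psi b1 b2)) (rr (psi b1 b2) * sin (psi b1 b2)) in
    beyond b1 1 (vec3 xm rm 0) p /\ beyond b2 2%:R (vec3 xm rm 0) p.
  move=> rr1 /=; have rrpos a : 0 < rr a by apply: lt_le_trans (rr1 a).
  have c0 : 0 < cos phi by rewrite -(pmulr_rgt0 _ r10); lra.
  have big a : rm < rr a * cos phi.
    by apply: le_lt_trans rm2 (lt_le_trans cphi _); rewrite ler_wpM2r// ltW.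
  rewrite /psi /beyond; case: b1; case: b2; rewrite !vec3E ?cosN ?sinN ?cos_pihalf ?sin_pihalf;
    rewrite ?mulr0 ?mulr1 ?mulrN ?mulr1; split => //; rewrite ?oppr_lt0 ?mulr_gt0//.
have := @surrounded_interior R C (vec3 xm rm 0) cC.
have [_ nI] : closure (C : set 'rV[R]_3) (vec3 xm rm 0) /\
    ~ interior (C : set 'rV[R]_3) (vec3 xm rm 0) by move: Hm; rewrite SE.
move=> HI; apply/nI/HI => b0 b1 b2; case: b0.
  have [? ?] := side xb rb b1 b2 (fun a => (Hb a).1).
  exists (vec3 xb (rb (psi b1 b2) * cos (psi b1 b2)) (rb (psi b1 b2) * sin (psi b1 b2))).
    by apply: clS; have [] := Hb (psi b1 b2).
  by split=> //; rewrite /beyond !vec3E.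
have [? ?] := side xa ra b1 b2 (fun a => (Ha a).1).
exists (vec3 xa (ra (psi b1 b2) * cos (psi b1 b2)) (ra (psi b1 b2) * sin (psi b1 b2))).
  by apply: clS; have [] := Ha (psi b1 b2).
by split=> //; rewrite /beyond !vec3E.
Unshelve. all: by end_near. Qed.

End Waist.

Theorem theorem3p11 (R : realType) (G : R -> R)
    (HG : class_C 7 G) (HG2 : forall c, 0 < derive1n 2 G c)
    (Hg : forall c, 0 < gfun G c)
    (x0 x1 x2 x3 x4 x5 : R)
    (h0 : 1 <= x0) (h01 : x0 < x1) (h12 : x1 < x2) (h23 : x2 < x3)
    (h34 : x3 < x4) (h45 : x4 < x5)
    (cI cO : R) (hI : 0 < cI) (hIO : cI < cO)
    (c0 : R -> R)
    (hc0 : smooth_on_itv (x0 - 1) (x5 + 1) c0)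
    (hc0b : forall x : R, x \in `[x0 - 1, x5 + 1] -> cI <= c0 x <= cO)
    (hc0l : forall x : R, x \in `[x0 - 1, x1] -> c0 x = cO)
    (hc0r : forall x : R, x \in `[x4, x5 + 1] -> c0 x = cO)
    (hc0m : forall x : R, x \in `[x2, x3] -> c0 x = cI)
    (u0 : 'rV[R]_3 -> R)
    (hu0 : forall (x phi : R), x \in `[x0 - 1, x5 + 1] -> phi \in `[0, pi *+ 2] ->
      u0 (revol x0 x5 x phi) = c0 x) :
  let Sigma := capsule x0 x5 in
  (closed_hypersurface Sigma /\ bounds_convex Sigma) /\
  forall nu : 'rV[R]_3 -> 'rV[R]_3, unit_normal Sigma id nu ->
    (short_time_existence R ->
      exists T rho u, evolution G Sigma nu u0 T rho u) /\
    (forall T rho u, evolution G Sigma nu u0 T rho u ->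
      exists t, [/\ 0 < t, t <= T &
        ~ bounds_convex (graph_surface Sigma nu rho t)]).
Proof.
move=> Sigma; have x05 : x0 < x5 by lra.
have cS : closed_hypersurface Sigma by exact: capsule_closed_hypersurface.
split; first by split=> //; exact: capsule_bounds_convex.
have u0E z : Sigma z -> u0 z = c0 (z 0 0).
  by move=> [x xI [phi phiI <-]]; rewrite hu0// -[revol _ _ _ _]/(vec3 _ _ _) vec3E.
move=> nu unu; split.
  move=> ste; have enG : energy_density G by [].
  have ku0 : Ck_on Sigma 4 u0.
    by apply: (@Ck_on_u0 R x0 x5 x05 x1 x4 cO c0) => //; lra.
  have [T0 T00 HT] := ste G Sigma nu u0 enG cS unu ku0.
  by exists T0; exact: HT.
move=> T rho u ev.
have T0 : 0 < T by case: ev => [? [? [? []]]].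
pose gI := gfun G cI; pose gO := gfun G cO.
have gOI : gO < gI by exact: gfun_decr.
have gO0 : 0 < gO by exact: Hg.
pose e := (gI - gO) / 3%:R.
have e0 : 0 < e by rewrite divr_gt0// subr_gt0.
have eE : e *+ 3 = gI - gO by rewrite /e -mulr_natr divfK// pnatr_eq0.
pose xa := (x0 + x1) / 2%:R; pose xm := (x2 + x3) / 2%:R; pose xb := (x4 + x5) / 2%:R.
have xaI : x0 < xa < x1 by apply/andP; split; rewrite /xa /xm /xb; lra.
have xmI : x2 < xm < x3 by apply/andP; split; rewrite /xa /xm /xb; lra.
have xbI : x4 < xb < x5 by apply/andP; split; rewrite /xa /xm /xb; lra.
have SE x phi : x \in `[x0 - 1, x5 + 1] -> Sigma (revol x0 x5 x phi).
  by move=> xI; rewrite /Sigma capsuleE//; exact: capsule_fun_revol.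
have u0R x phi : x \in `[x0 - 1, x5 + 1] -> u0 (revol x0 x5 x phi) = c0 x.
  by move=> xI; rewrite u0E; [rewrite -[revol _ _ _ _]/(vec3 _ _ _) vec3E|exact: SE].
have xaS : xa \in `[x0 - 1, x5 + 1].
  by have /andP[? ?] := xaI; rewrite in_itv/=; apply/andP; split; lra.
have xmS : xm \in `[x0 - 1, x5 + 1].
  by have /andP[? ?] := xmI; rewrite in_itv/=; apply/andP; split; lra.
have xbS : xb \in `[x0 - 1, x5 + 1].
  by have /andP[? ?] := xbI; rewrite in_itv/=; apply/andP; split; lra.
have ca phi : u0 (revol x0 x5 xa phi) = cO.
  rewrite u0R// hc0l//.
  by have /andP[? ?] := xaI; rewrite in_itv/=; apply/andP; split; lra.
have cm phi : u0 (revol x0 x5 xm phi) = cI.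
  rewrite u0R// hc0m//.
  by have /andP[? ?] := xmI; rewrite in_itv/=; apply/andP; split; lra.
have cb phi : u0 (revol x0 x5 xb phi) = cO.
  rewrite u0R// hc0r//.
  by have /andP[? ?] := xbI; rewrite in_itv/=; apply/andP; split; lra.
(* The error e is a third of the gap between the two speeds, so that the radii stay separated. *)
have near1 := initial_velocity x05 unu ev e0.
(* The bound on t * (gI + e) keeps the middle radius positive. *)
have [t [t0 tT tsmall Ht]] : exists t, [/\ 0 < t, t <= T, t * (gI + e) < 1 &
    forall x phi, x0 < x < x5 -> exists2 r,
      `|(r - 1) / t + gfun G (u0 (revol x0 x5 x phi))| <= e &
      graph_param nu rho t (revol x0 x5 x phi) = vec3 x (r * cos phi) (r * sin phi)].
  have n1 : \forall t \near 0^'+, t \in `[0, T] -> forall x phi,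
     x0 < x < x5 -> exists2 r,
      `|(r - 1) / t + gfun G (u0 (revol x0 x5 x phi))| <= e &
      graph_param nu rho t (revol x0 x5 x phi) = vec3 x (r * cos phi) (r * sin phi).
    have near1' : nbhs (0 : R) [set t | t != 0 -> t \in `[0, T] -> forall x phi,
     x0 < x < x5 -> exists2 r,
      `|(r - 1) / t + gfun G (u0 (revol x0 x5 x phi))| <= e &
      graph_param nu rho t (revol x0 x5 x phi) = vec3 x (r * cos phi) (r * sin phi)].
      exact: near1.
    have : nbhs (0 : R) [set t | 0 < t -> t \in `[0, T] -> forall x phi,
     x0 < x < x5 -> exists2 r,
      `|(r - 1) / t + gfun G (u0 (revol x0 x5 x phi))| <= e &
      graph_param nu rho t (revol x0 x5 x phi) = vec3 x (r * cos phi) (r * sin phi)].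
      by apply: filterS near1' => t H t0; apply: H; rewrite gt_eqF.
    exact.
  have ge0 : 0 < (gI + e)^-1 by rewrite invr_gt0; lra.
  near (0 : R)^'+ => t.
  have t0 : 0 < t by near: t; exact: nbhs_right_gt.
  have tT : t <= T by apply: ltW; near: t; exact: nbhs_right_lt.
  have ti : t < (gI + e)^-1 by near: t; exact: nbhs_right_lt.
  exists t; split=> //; first by rewrite -ltr_pdivlMr ?div1r// -invr_gt0.
  have : t \in `[0, T] by rewrite in_itv/= tT ltW.
  by near: t; exact: n1.
exists t; split=> //.
have bound x phi c : x0 < x < x5 -> u0 (revol x0 x5 x phi) = c ->
    exists2 r, 1 - t * (gfun G c + e) <= r <= 1 - t * (gfun G c - e) &
      graph_surface Sigma nu rho t (vec3 x (r * cos phi) (r * sin phi)).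
  move=> xI ucE; have [r rE gE] := Ht x phi xI; exists r.
    move: rE; rewrite ucE ler_norml => /andP[l1 l2].
    have rt : r - 1 = (r - 1) / t * t by rewrite divfK// gt_eqF.
    have k1 : (- e - gfun G c) * t <= (r - 1) / t * t.
      by apply: ler_wpM2r; [exact: ltW|lra].
    have k2 : (r - 1) / t * t <= (e - gfun G c) * t.
      by apply: ler_wpM2r; [exact: ltW|lra].
    by rewrite -rt in k1 k2; apply/andP; split; lra.
  exists (revol x0 x5 x phi) => //; apply: SE.
  by have /andP[? ?] := xI; rewrite in_itv/=; apply/andP; split; lra.
have /choice[ra Hra] : forall phi, exists r, 1 - t * (gO + e) <= r /\
    graph_surface Sigma nu rho t (vec3 xa (r * cos phi) (r * sin phi)).
  move=> phi; have [|r /andP[r1 r2] rS] := @bound xa phi cO _ (ca phi).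
    by have /andP[? ?] := xaI; apply/andP; split; lra.
  by exists r.
have /choice[rb Hrb] : forall phi, exists r, 1 - t * (gO + e) <= r /\
    graph_surface Sigma nu rho t (vec3 xb (r * cos phi) (r * sin phi)).
  move=> phi; have [|r /andP[r1 r2] rS] := @bound xb phi cO _ (cb phi).
    by have /andP[? ?] := xbI; apply/andP; split; lra.
  by exists r.
have [|rm /andP[rm1 rm2]] := @bound xm 0 cI _ (cm 0).
  by have /andP[? ?] := xmI; apply/andP; split; lra.
rewrite cos0 sin0 mulr1 mulr0 => rmS.
apply: (waist_not_convex (r1 := 1 - t * (gO + e)) _ _ _ _ rm2 Hra Hrb rmS).
- by move/andP: xaI xmI => [? ?] /andP[? ?]; lra.
- by move/andP: xbI xmI => [? ?] /andP[? ?]; lra.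
- by rewrite ltrD2l ltrN2 ltr_pM2l// -/gI; lra.
- by apply: lt_le_trans rm1; rewrite subr_gt0.
Unshelve. all: by end_near. Qed.
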